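(* Let $k$ be a field. (a) If $n\ge 3$, then $\mathrm{Aut}(A(\Gamma_{D_n}))=k^*\times D_n$, where $D_n$ is the dihedral group of order $2n$, acting through its action by graph automorphisms on the vertices of $\Gamma_{D_n}$, and $\alpha\in k^*$ acts by multiplying every generator by $\alpha$. (b) If $n=2$, then $$\mathrm{Aut}(A(\Gamma_{D_2}))\cong\left\{M\in GL(3,k): M=\begin{bmatrix} c_1^1+c_2^1 & c_1^2-c_2^1 & c_2^1-c_1^2\\ 0&c_1^1&c_2^1\\ 0&c_1^2&c_1^1+c_2^1-c_1^2\end{bmatrix},\ c_i^j\in k\right\}.$$ Here $M$ records the action on generators: the element $rv_{12}+sw_1+tw_2$, written as the row vector $[r\ s\ t]$, is sent to $[r\ s\ t]M$.
   Context: For $n\ge 3$, $\Gamma_{D_n}$ is the Hasse graph of the face poset of an $n$-gon: a minimal vertex $*$ in level $0$; vertices $w_1,\dots,w_n$ in level $1$; vertices $v_{12},v_{23},\dots,v_{n1}$ in level $2$; a top vertex $u$ in level $3$ (indices in $\mathbb Z/(n)$). There are edges from $u$ to every $v_{i\,i+1}$, from $v_{i\,i+1}$ to $w_i$ and $w_{i+1}$, and from every $w_i$ to $*$. The algebra $A(\Gamma_{D_n})$ is the associative unital $k$-algebra generated by $u,\ v_{i\,i+1},\ w_i$ ($1\le i\le n$) with relations, for $1\le i\le n$, 1) $v_{i\,i+1}(w_i-w_{i+1})-w_i^2+w_{i+1}^2=0$; 2) $u(v_{i\,i+1}-v_{i+1\,i+2})-v_{i\,i+1}^2+v_{i+1\,i+2}^2+(v_{i\,i+1}-v_{i+1\,i+2})w_{i+1}=0$.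 For $n=2$, $\Gamma_{D_2}$ has vertices $*$ (level $0$), $w_1,w_2$ (level $1$) and a single vertex $v_{12}$ (level $2$), with edges from $v_{12}$ to $w_1,w_2$ and from $w_1,w_2$ to $*$; $A(\Gamma_{D_2})$ is generated by $v_{12},w_1,w_2$ with the single relation $v_{12}(w_1-w_2)-w_1^2+w_2^2=0$. These algebras $A$ are graded by word length in the generators, $A=\bigoplus_i A_{[i]}$ (the relations are homogeneous quadratic). They also carry an increasing filtration $A_{(i)}$: giving each generator the weight equal to its level, $A_{(i)}$ is the span of the products of generators of total weight at most $i$. $\mathrm{Aut}(A)$ denotes the group of automorphisms of the graded algebra $A$ (algebra automorphisms preserving each $A_{[i]}$) that preserve the filtration (mapping each $A_{(i)}$ onto itself). *)

(* Defs.v *)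
From HB Require Import structures.
From mathcomp Require Import all_boot all_algebra all_fingroup all_solvable.
From mathcomp Require Import generic_quotient.
From mathcomp Require Import boolp classical_sets.
From mathcomp Require Import monalg.

Set Implicit Arguments.
Unset Strict Implicit.
Unset Printing Implicit Defensive.

Import GRing.Theory.

Local Open Scope ring_scope.
Local Open Scope quotient_scope.

(** * Unit groups: [units k] is k^*, [units 'M[k]_n.+1] is GL(n+1, k) *)

Record units (R : unitRingType) :=
  Units { uval :> R; uvalP : uval \is a GRing.unit }.

HB.instance Definition _ (R : unitRingType) := [isSub for @uval R].
HB.instance Definition _ (R : unitRingType) := [Choice of units R by <:].

Section UnitsGroup.
Variable R : unitRingType.
Implicit Types x y z : units R.

Fact units_mul_subproof x y : uval x * uval y \is a GRing.unit.
Proof. by rewrite unitrMl ?uvalP. Qed.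

Fact units_inv_subproof x : (uval x)^-1 \is a GRing.unit.
Proof. by rewrite unitrV uvalP. Qed.

Definition units_one : units R := Units (unitr1 R).
Definition units_mul x y : units R := Units (units_mul_subproof x y).
Definition units_inv x : units R := Units (units_inv_subproof x).

Fact units_mulA : associative units_mul.
Proof. by move=> x y z; apply/val_inj; rewrite /= mulrA. Qed.
Fact units_mul1 : left_id units_one units_mul.
Proof. by move=> x; apply/val_inj; rewrite /= mul1r. Qed.
Fact units_mulr1 : right_id units_one units_mul.
Proof. by move=> x; apply/val_inj; rewrite /= mulr1. Qed.
Fact units_mulV : left_inverse units_one units_inv units_mul.
Proof. by move=> x; apply/val_inj; rewrite /= mulVr ?uvalP. Qed.
Fact units_mulrV : right_inverse units_one units_inv units_mul.
Proof. by move=> x; apply/val_inj; rewrite /= mulrV ?uvalP. Qed.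

HB.instance Definition _ := isGroup.Build (units R)
  units_mulA units_mul1 units_mulr1 units_mulV units_mulrV.

End UnitsGroup.

(** * Algebras presented by generators, with levels, and relations *)

Notation free_alg k X := {malg k[{fmonom X}]}.

Definition fgen {k : fieldType} {X : choiceType} (x : X) : free_alg k X :=
  << 1 *g fmu x >>.

Definition const_term {k : fieldType} {X : choiceType} (a : free_alg k X) : k :=
  mcoeff (mone : {fmonom X}) a.

(* The condition on constant terms makes the presented algebra nonzero, as the
   MathComp structure of algebra demands; it holds for quadratic relators. *)
Record presentation (k : fieldType) := Presentation {
  gen_type : choiceType;
  level : gen_type -> nat;
  relators : seq (free_alg k gen_type);
  relators_const : {in relators, forall r, const_term r = 0}
}.

Fact scalerAr_central (k : fieldType) (A : lalgType k) :
  (forall (c : k) (a : A), (c *: 1) * a = a * (c *: 1)) ->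
  forall (c : k) (a b : A), c *: (a * b) = a * (c *: b).
Proof.
move=> cC c a b.
by rewrite -[a * b]mul1r scalerAl mulrA cC -mulrA -scalerAl mul1r.
Qed.

Fact const_fgen (k : fieldType) (X : choiceType) (x : X) :
  const_term (fgen x : free_alg k X) = 0.
Proof. by rewrite /const_term /fgen mcoeffU fmP fm1 fmuE. Qed.

Section PresentedAlgebra.
Variables (k : fieldType) (P : presentation k).

Local Notation F := (free_alg k (gen_type P)).

(* The two-sided ideal generated by the relators. *)
Definition rel_ideal (a : F) : Prop :=
  exists2 s : seq (F * F * F),
    {in s, forall t, t.1.2 \in relators P} &
    a = \sum_(t <- s) t.1.1 * t.1.2 * t.2.

Fact rel_ideal0 : rel_ideal 0.
Proof. by exists [::]; rewrite ?big_nil. Qed.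

Fact rel_idealD a b : rel_ideal a -> rel_ideal b -> rel_ideal (a + b).
Proof.
move=> [s sP ->] [t tP ->]; exists (s ++ t); last by rewrite big_cat.
by move=> u; rewrite mem_cat => /orP[/sP|/tP].
Qed.

Fact rel_idealMM a x y : rel_ideal a -> rel_ideal (x * a * y).
Proof.
move=> [s sP ->].
exists [seq (x * t.1.1, t.1.2, t.2 * y) | t <- s].
  by move=> _ /mapP[t ts ->] /=; apply: sP.
rewrite big_map mulr_sumr mulr_suml; apply: eq_bigr => -[[u r] v] _.
by rewrite [x * (u * r * v)]mulrA [x * (u * r)]mulrA -[LHS]mulrA.
Qed.

Fact rel_idealMl x a : rel_ideal a -> rel_ideal (x * a).
Proof. by move=> /(rel_idealMM x 1); rewrite mulr1. Qed.

Fact rel_idealMr x a : rel_ideal a -> rel_ideal (a * x).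
Proof. by move=> /(rel_idealMM 1 x); rewrite mul1r. Qed.

Fact rel_idealN a : rel_ideal a -> rel_ideal (- a).
Proof. by move=> /(rel_idealMl (-1)); rewrite mulN1r. Qed.

Fact rel_idealZ c a : rel_ideal a -> rel_ideal (c *: a).
Proof. by move=> /(rel_idealMl (c *: 1)); rewrite -scalerAl mul1r. Qed.

Fact rel_ideal_const a : rel_ideal a -> const_term a = 0.
Proof.
move=> [s sP ->]; rewrite /const_term raddf_sum /= big_seq big1 // => t ts.
by rewrite !rmorphM /= [X in _ * X * _](relators_const (sP t ts)) mulr0 mul0r.
Qed.

Definition rel_equiv (a b : F) : bool := `[< rel_ideal (a - b) >].

Fact rel_equiv_refl : reflexive rel_equiv.
Proof. by move=> a; apply/asboolP; rewrite subrr; apply: rel_ideal0. Qed.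

Fact rel_equiv_sym : symmetric rel_equiv.
Proof.
move=> a b; apply/asboolP/asboolP => /rel_idealN; by rewrite opprB.
Qed.

Fact rel_equiv_trans : transitive rel_equiv.
Proof.
move=> b a c /asboolP ab /asboolP bc; apply/asboolP.
by have := rel_idealD ab bc; rewrite addrA subrK.
Qed.

Canonical rel_equiv_rel :=
  EquivRel rel_equiv rel_equiv_refl rel_equiv_sym rel_equiv_trans.

Definition presented_alg := {eq_quot rel_equiv_rel}.
HB.instance Definition _ := Choice.on presented_alg.
HB.instance Definition _ := EqQuotient.on presented_alg.

Definition alg_pi (a : F) : presented_alg := \pi_presented_alg a.

Fact alg_piP a b : alg_pi a = alg_pi b <-> rel_ideal (a - b).
Proof.
split; last by move=> ab; apply/eqmodP/asboolP.
by move=> /eqmodP /asboolP.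
Qed.

Fact alg_reprP a : rel_ideal (repr (alg_pi a) - a).
Proof. by apply/alg_piP; rewrite /alg_pi reprK. Qed.

Fact alg_reprK (x : presented_alg) : alg_pi (repr x) = x.
Proof. exact: reprK. Qed.

Definition alg_one := alg_pi 1.
Definition alg_opp (x : presented_alg) := alg_pi (- repr x).
Definition alg_add (x y : presented_alg) := alg_pi (repr x + repr y).
Definition alg_mul (x y : presented_alg) := alg_pi (repr x * repr y).
Definition alg_scale (c : k) (x : presented_alg) := alg_pi (c *: repr x).

Fact alg_piN a : alg_pi (- a) = alg_opp (alg_pi a).
Proof.
by apply/alg_piP; rewrite opprK addrC; apply: alg_reprP.
Qed.

Fact alg_piD a b : alg_pi (a + b) = alg_add (alg_pi a) (alg_pi b).
Proof.
apply/esym/alg_piP; rewrite opprD addrACA.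
by apply: rel_idealD; apply: alg_reprP.
Qed.

Fact alg_piZ c a : alg_pi (c *: a) = alg_scale c (alg_pi a).
Proof.
by apply/esym/alg_piP; rewrite -scalerBr; apply/rel_idealZ/alg_reprP.
Qed.

Fact alg_piM a b : alg_pi (a * b) = alg_mul (alg_pi a) (alg_pi b).
Proof.
apply/esym/alg_piP; set a' := repr _; set b' := repr _.
have -> : a' * b' - a * b = (a' - a) * b' + a * (b' - b).
  by rewrite mulrBl mulrBr addrA subrK.
by apply: rel_idealD; [apply: rel_idealMr|apply: rel_idealMl]; apply: alg_reprP.
Qed.


Fact alg_addA : associative alg_add.
Proof.
move=> x y z; rewrite -[x]alg_reprK -[y]alg_reprK -[z]alg_reprK.
by rewrite -!alg_piD addrA.
Qed.
Fact alg_addC : commutative alg_add.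
Proof. by move=> x y; rewrite /alg_add addrC. Qed.
Fact alg_add0 : left_id (alg_pi 0) alg_add.
Proof. by move=> x; rewrite -[x]alg_reprK -alg_piD add0r. Qed.
Fact alg_addN : left_inverse (alg_pi 0) alg_opp alg_add.
Proof. by move=> x; rewrite -[x]alg_reprK -alg_piN -alg_piD addNr. Qed.

HB.instance Definition _ :=
  GRing.isZmodule.Build presented_alg alg_addA alg_addC alg_add0 alg_addN.

Fact alg_mulA : associative alg_mul.
Proof.
move=> x y z; rewrite -[x]alg_reprK -[y]alg_reprK -[z]alg_reprK.
by rewrite -!alg_piM mulrA.
Qed.
Fact alg_mul1 : left_id alg_one alg_mul.
Proof. by move=> x; rewrite -[x]alg_reprK -alg_piM mul1r. Qed.
Fact alg_mulr1 : right_id alg_one alg_mul.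
Proof. by move=> x; rewrite -[x]alg_reprK -alg_piM mulr1. Qed.
Fact alg_mulDl : left_distributive alg_mul alg_add.
Proof.
move=> x y z; rewrite -[x]alg_reprK -[y]alg_reprK -[z]alg_reprK.
by rewrite -!(alg_piM, alg_piD) mulrDl.
Qed.
Fact alg_mulDr : right_distributive alg_mul alg_add.
Proof.
move=> x y z; rewrite -[x]alg_reprK -[y]alg_reprK -[z]alg_reprK.
by rewrite -!(alg_piM, alg_piD) mulrDr.
Qed.
Fact alg_one_neq0 : alg_one != 0.
Proof.
apply/eqP => /alg_piP; rewrite subr0 => /rel_ideal_const /eqP.
by rewrite /const_term rmorph1 oner_eq0.
Qed.

HB.instance Definition _ := GRing.Zmodule_isNzRing.Build presented_alg
  alg_mulA alg_mul1 alg_mulr1 alg_mulDl alg_mulDr alg_one_neq0.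

Fact alg_scaleA c d x : alg_scale c (alg_scale d x) = alg_scale (c * d) x.
Proof. by rewrite -[x]alg_reprK -!alg_piZ scalerA. Qed.
Fact alg_scale1 : left_id 1 alg_scale.
Proof. by move=> x; rewrite -[x]alg_reprK -alg_piZ scale1r. Qed.
Fact alg_scaleDr : right_distributive alg_scale +%R.
Proof.
move=> c x y; rewrite -[x]alg_reprK -[y]alg_reprK.
by rewrite -[_ + _]alg_piD -!alg_piZ -[RHS]alg_piD scalerDr.
Qed.
Fact alg_scaleDl x : {morph alg_scale^~ x : c d / c + d}.
Proof.
by move=> c d; rewrite -[x]alg_reprK -!alg_piZ -[RHS]alg_piD scalerDl.
Qed.

HB.instance Definition _ := GRing.Zmodule_isLmodule.Build k presented_alg
  alg_scaleA alg_scale1 alg_scaleDr alg_scaleDl.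

Fact alg_scaleAl (c : k) (x y : presented_alg) : c *: (x * y) = (c *: x) * y.
Proof.
rewrite -[x]alg_reprK -[y]alg_reprK.
rewrite -[_ * _]alg_piM -[_ *: alg_pi (repr x)]alg_piZ -[RHS]alg_piM.
by rewrite -scalerAl [RHS]alg_piZ.
Qed.

HB.instance Definition _ :=
  GRing.Lmodule_isLalgebra.Build k presented_alg alg_scaleAl.

Fact free_scaleAr (c : k) (a b : F) : c *: (a * b) = a * (c *: b).
Proof.
apply: scalerAr_central b => {}c {}a.
rewrite -(mul_malgC c 1) mulr1 !malgM_def fgmulUg fgmulgU.
by apply: eq_bigr => w _; rewrite mulrC mul1m mulm1.
Qed.

Fact alg_scaleAr (c : k) (x y : presented_alg) : c *: (x * y) = x * (c *: y).
Proof.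
rewrite -[x]alg_reprK -[y]alg_reprK.
rewrite -[_ * _]alg_piM -[_ *: alg_pi (repr y)]alg_piZ -[RHS]alg_piM.
by rewrite -free_scaleAr [RHS]alg_piZ.
Qed.

HB.instance Definition _ :=
  GRing.Lalgebra_isAlgebra.Build k presented_alg alg_scaleAr.

Definition agen (x : gen_type P) : presented_alg := alg_pi (fgen x).

Definition word (s : seq (gen_type P)) : presented_alg :=
  \prod_(x <- s) agen x.

Definition weight (s : seq (gen_type P)) : nat := (\sum_(x <- s) level x)%N.

Definition word_span (p : pred (seq (gen_type P))) : set presented_alg :=
  [set a | exists2 c : seq (k * seq (gen_type P)),
     {in c, forall t, p t.2} & a = \sum_(t <- c) t.1 *: word t.2]%classic.

(* A_[i] *)
Definition graded_part (i : nat) := word_span (fun s => size s == i).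

(* A_(i) *)
Definition filtered_part (i : nat) := word_span (fun s => (weight s <= i)%N).

End PresentedAlgebra.

Arguments agen {k P}.

(** * Automorphisms preserving two families of subsets *)

Section Automorphisms.
Variables (k : fieldType) (A : algType k) (G F : nat -> set A).

Definition gf_aut (f : A -> A) : Prop :=
  [/\ linear f, GRing.monoid_morphism f, bijective f,
      forall i, (f @` G i = G i)%classic
    & forall i, (f @` F i = F i)%classic].

Record Aut := MkAut { aut_fun :> A -> A;
                      aut_funP : `[< gf_aut aut_fun >] }.

HB.instance Definition _ := [isSub for aut_fun].
HB.instance Definition _ := [Choice of Aut by <:].

Implicit Types f g : Aut.

Fact autP f : gf_aut f.
Proof. exact/asboolP/aut_funP. Qed.

Fact gf_aut_id : gf_aut id.
Proof.
split=> //; first exact: (Bijective (g := id)).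
- by move=> i; rewrite image_id.
- by move=> i; rewrite image_id.
Qed.

Fact gf_aut_comp f g : gf_aut (g \o f).
Proof.
have [fl [f1 fM] fb fG fF] := autP f; have [gl [g1 gM] gb gG gF] := autP g.
split=> [c x y|||i|i]; rewrite ?image_comp.
- by rewrite /= fl gl.
- by split=> [|x y] /=; rewrite ?f1 ?g1 // fM gM.
- exact: bij_comp.
- by rewrite -image_comp fG gG.
- by rewrite -image_comp fF gF.
Qed.

Fact gf_aut_inv f : exists2 h, gf_aut h & cancel f h /\ cancel h f.
Proof.
have [fl [f1 fM] [h fK hK] fG fF] := autP f; exists h => //.
have hS (S : set A) : (f @` S = S -> h @` S = S)%classic.
  by move=> fS; rewrite -{1}fS image_comp (_ : h \o f = id) ?image_id //;
     apply/funext.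
split=> [c x y|||i|i].
- by apply: (can_inj fK); rewrite fl !hK.
- split=> [|x y]; apply: (can_inj fK); first by rewrite hK f1.
  by rewrite fM !hK.
- exact: (Bijective hK fK).
- exact/hS/fG.
- exact/hS/fF.
Qed.

Definition aut_one : Aut := MkAut (asboolT gf_aut_id).

(* [f * g] is f followed by g, as for permutations in MathComp; this is also
   the order in which matrices acting on row vectors are multiplied. *)
Definition aut_mul f g : Aut := MkAut (asboolT (gf_aut_comp f g)).

Definition aut_inv f : Aut := MkAut (asboolT (s2valP (cid2 (gf_aut_inv f)))).

Fact aut_mulA : associative aut_mul.
Proof. by move=> f g h; apply: val_inj. Qed.
Fact aut_mul1 : left_id aut_one aut_mul.
Proof. by move=> f; apply: val_inj. Qed.
Fact aut_mulr1 : right_id aut_one aut_mul.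
Proof. by move=> f; apply: val_inj. Qed.
Fact aut_mulV : left_inverse aut_one aut_inv aut_mul.
Proof.
move=> f; apply: val_inj; apply/funext => x /=.
by case: cid2 => /= h _ [_ hK]; rewrite hK.
Qed.
Fact aut_mulrV : right_inverse aut_one aut_inv aut_mul.
Proof.
move=> f; apply: val_inj; apply/funext => x /=.
by case: cid2 => /= h _ [fK _]; rewrite fK.
Qed.

HB.instance Definition _ := isGroup.Build Aut
  aut_mulA aut_mul1 aut_mulr1 aut_mulV aut_mulrV.

End Automorphisms.

(* The automorphisms of the graded algebra that preserve the filtration. *)
Notation AutGF P := (Aut (@graded_part _ P) (@filtered_part _ P)).

(** * The algebra of the n-gon *)

Fact rmorph_rel1 (R S : nzRingType) (f : {rmorphism R -> S}) (a b c : R) :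
  f a = 0 -> f b = 0 -> f c = 0 -> f (a * (b - c) - b ^+ 2 + c ^+ 2) = 0.
Proof.
move=> fa fb fc; rewrite rmorphD rmorphB rmorphM !rmorphXn fa fb fc.
by rewrite mul0r expr0n subr0 addr0.
Qed.

Fact rmorph_rel2 (R S : nzRingType) (f : {rmorphism R -> S}) (a b c d : R) :
  f a = 0 -> f b = 0 -> f c = 0 -> f d = 0 ->
  f (a * (b - c) - b ^+ 2 + c ^+ 2 + (b - c) * d) = 0.
Proof.
move=> fa fb fc fd; rewrite rmorphD rmorph_rel1 // rmorphM fd mulr0.
by rewrite addr0.
Qed.

Section Polygon.
Variable n : nat.

(* The vertices above the minimal one, with indices from 0 to n - 1;
   [gV i] is v_{i i+1}. *)
Inductive gen := gU | gV of 'I_n | gW of 'I_n.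

Definition gen_code (x : gen) : option ('I_n + 'I_n) :=
  match x with gU => None | gV i => Some (inl i) | gW i => Some (inr i) end.
Definition gen_decode (x : option ('I_n + 'I_n)) : gen :=
  match x with None => gU | Some (inl i) => gV i | Some (inr i) => gW i end.
Fact gen_codeK : cancel gen_code gen_decode.
Proof. by case. Qed.
HB.instance Definition _ := Finite.copy gen (can_type gen_codeK).

Definition gen_level (x : gen) : nat :=
  match x with gU => 3%N | gV _ => 2%N | gW _ => 1%N end.

(* Edges, directed downwards; [None] is the minimal vertex. *)
Definition hasse_edge : rel (option gen) := fun x y =>
  match x, y with
  | Some gU, Some (gV _) => true
  | Some (gV i), Some (gW j) => (j == i) || (j == ordS i)
  | Some (gW _), None => true
  | _, _ => false
  end.

Definition rot_fun (x : gen) : gen :=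
  match x with gU => gU | gV i => gV (ordS i) | gW i => gW (ordS i) end.

(* The reflection w_i |-> w_{n-1-i} exchanges the ends of edges. *)
Definition refl_fun (x : gen) : gen :=
  match x with
  | gU => gU
  | gV i => gV (rev_ord (ordS i))
  | gW i => gW (rev_ord i)
  end.

Fact gV_inj : injective gV. Proof. by move=> i j []. Qed.
Fact gW_inj : injective gW. Proof. by move=> i j []. Qed.

Fact rot_inj : injective rot_fun.
Proof.
by case=> [|i|i] [|j|j] //= => [/gV_inj|/gW_inj] /ordS_inj ->.
Qed.

Fact ordS_rev (i : 'I_n) : ordS (rev_ord (ordS i)) = rev_ord i.
Proof.
apply/val_inj => /=; have := ltn_ord i; rewrite leq_eqVlt => /orP[/eqP iE|lti].
  by rewrite iE modnn subn1 prednK ?modnn ?subnn // -iE.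
by rewrite (modn_small lti) subnSK // modn_small // ltn_subrL (leq_ltn_trans _ lti).
Qed.

Fact refl_inj : injective refl_fun.
Proof.
case=> [|i|i] [|j|j] //= => [/gV_inj|/gW_inj] /rev_ord_inj; last by move=> ->.
by move=> /ordS_inj ->.
Qed.

Definition rot : {perm gen} := perm rot_inj.
Definition refl : {perm gen} := perm refl_inj.

(* For n >= 3, the dihedral group of order 2n. *)
Definition dihedral : {group {perm gen}} := <<[set rot; refl]>>%G.

Definition graph_aut (s : {perm gen}) : Prop :=
  forall x y, hasse_edge (omap s x) (omap s y) = hasse_edge x y.

Fact rot_graph_aut : graph_aut rot.
Proof.
by case=> [[|i|i]|] [[|j|j]|] //=; rewrite !permE //= !(inj_eq (@ordS_inj n)).
Qed.

Fact refl_graph_aut : graph_aut refl.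
Proof.
case=> [[|i|i]|] [[|j|j]|] //=; rewrite !permE //= ordS_rev.
by rewrite !(inj_eq rev_ord_inj) orbC.
Qed.

Lemma dihedral_graph_aut (s : {perm gen}) : s \in dihedral -> graph_aut s.
Proof.
case/gen_prodgP => m [c cP ->].
apply: (big_ind graph_aut) => [x y|a b aP bP x y|i _].
- by rewrite !(eq_omap (@perm1 _)) !omap_id.
- have abE z : omap (a * b)%g z = omap b (omap a z).
    by case: z => //= z; rewrite permM.
  by rewrite !abE bP aP.
- by have := cP i; rewrite !inE => /orP[] /eqP ->;
    [apply: rot_graph_aut|apply: refl_graph_aut].
Qed.

Fact rotX m (i : 'I_n) : (rot ^+ m)%g (gW i) = gW (iter m (@ordS n) i).
Proof.
by elim: m => [|m IHm]; rewrite ?perm1 // expgSr permM IHm permE /=.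
Qed.

Fact val_iter_ordS m (i : 'I_n) : iter m (@ordS n) i = ((i + m) %% n)%N :> nat.
Proof.
elim: m => [|m IHm]; first by rewrite addn0 modn_small.
by rewrite iterS /= IHm -addn1 modnDml addn1 addnS.
Qed.

Fact rotXn : (rot ^+ n)%g = 1%g.
Proof.
have it i : iter n (@ordS n) i = i.
  by apply/ord_inj; rewrite val_iter_ordS modnDr modn_small.
have itV m i : (rot ^+ m)%g (gV i) = gV (iter m (@ordS n) i).
  by elim: m => [|m IHm]; rewrite ?perm1 // expgSr permM IHm permE /=.
have itU m : (rot ^+ m)%g gU = gU.
  by elim: m => [|m IHm]; rewrite ?perm1 // expgSr permM IHm permE /=.
by apply/permP => -[|i|i]; rewrite perm1 ?itU ?itV ?rotX ?it.
Qed.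

Fact rot_dvdn m : (0 < n)%N -> (rot ^+ m)%g = 1%g -> (n %| m)%N.
Proof.
move=> n0 /permP/(_ (gW (Ordinal n0))); rewrite rotX perm1 => /gW_inj.
by move/(congr1 (@nat_of_ord n)); rewrite val_iter_ordS add0n /dvdn => ->.
Qed.

Fact refl2 : (refl ^+ 2)%g = 1%g.
Proof.
apply/permP => -[|i|i]; rewrite expgS expg1 permM perm1 !permE //=.
  by rewrite ordS_rev rev_ordK.
by rewrite rev_ordK.
Qed.

Fact rot_refl : (rot ^ refl)%g = rot^-1%g.
Proof.
apply/eqP; rewrite eq_sym eq_invg_mul conjgE mulgA.
have -> : refl^-1%g = refl by apply/eqP; rewrite eq_invg_mul -expg2 refl2.
apply/eqP/permP => -[|i|i]; rewrite !permM perm1 !permE //=.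
  by rewrite ordS_rev ordS_rev rev_ordK.
by rewrite ordS_rev rev_ordK.
Qed.

Lemma dihedral_isog : (2 < n)%N -> dihedral \isog 'D_(n.*2).
Proof.
move=> n3; have n1 : (1 < n)%N by apply: ltn_trans n3.
have n0 : (0 < n)%N by apply: ltn_trans n1.
have homD : (dihedral \homg 'D_(n.*2))%g.
  rewrite (Grp_dihedral n1); apply/existsP; exists (rot, refl).
  rewrite /= !xpair_eqE rotXn refl2 rot_refl !eqxx !andbT.
  by rewrite joing_idl joing_idr.
have rD : (<[rot]> \subset dihedral)%g by rewrite cycle_subG mem_gen ?set21.
have or : #[rot]%g = n.
  apply/eqP; rewrite eqn_dvd order_dvdn rotXn eqxx /=.
  by apply: rot_dvdn => //; apply: expg_order.
have ltD : (#|<[rot]>%g| < #|dihedral|)%N.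
  apply: proper_card; rewrite properE rD /=; apply/negP => Dr.
  have /cycleP[m reflE] : refl \in <[rot]>%g.
    have rD2 : refl \in dihedral by rewrite mem_gen ?set22.
    exact: (fintype.subsetP Dr).
  have := rot_refl; rewrite reflE conjgE (commuteX m (commute_refl rot)) mulKg.
  move/eqP; rewrite eq_sym eq_invg_mul -expg2 => /eqP /(rot_dvdn n0).
  by move/(dvdn_leq (ltn0Sn 1)); rewrite leqNgt n3.
rewrite isogEcard homD card_dihedral //.
have := cardSg rD; rewrite -[#|<[rot]>%g|]/#[rot]%g or => /dvdnP[q qE].
move: ltD; rewrite -[#|<[rot]>%g|]/#[rot]%g or qE -mul2n leq_mul2r.
by case: q {qE} => [|[|q]]; rewrite ?mul1n ?ltnn ?mul0n ?orbT.
Qed.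

Variable k : fieldType.

Local Notation u := (fgen gU : free_alg k gen).
Local Notation v i := (fgen (gV i) : free_alg k gen).
Local Notation w i := (fgen (gW i) : free_alg k gen).

Definition polygon_rel1 (i : 'I_n) : free_alg k gen :=
  let j := ordS i in
  v i * (w i - w j) - w i ^+ 2 + w j ^+ 2.

Definition polygon_rel2 (i : 'I_n) : free_alg k gen :=
  let j := ordS i in
  u * (v i - v j) - v i ^+ 2 + v j ^+ 2 + (v i - v j) * w j.

Definition polygon_relators : seq (free_alg k gen) :=
  [seq polygon_rel1 i | i <- enum 'I_n] ++ [seq polygon_rel2 i | i <- enum 'I_n].

Fact polygon_relators_const :
  {in polygon_relators, forall r, const_term r = 0}.
Proof.
move=> r; rewrite mem_cat => /orP[] /mapP[i _ ->].
  by apply: (rmorph_rel1 (f := mcoeff _)); apply: const_fgen.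
by apply: (rmorph_rel2 (f := mcoeff _)); apply: const_fgen.
Qed.

Definition polygon_presentation : presentation k :=
  Presentation gen_level polygon_relators_const.

Definition polygon_gen (x : gen) : presented_alg polygon_presentation :=
  @agen k polygon_presentation x.

End Polygon.

Arguments gU {n}.
Arguments polygon_gen {n k}.

(** * The algebra of the 2-gon *)

Section Digon.
Variable k : fieldType.

(* The vertices above the minimal one are v_12, w_1, w_2, in this order. *)
Definition digon_level (x : 'I_3) : nat := (if x == 0%R then 2 else 1)%N.

Definition digon_rel : free_alg k 'I_3 :=
  let v12 := fgen 0 in let w1 := fgen 1 in let w2 := fgen 2%:R in
  v12 * (w1 - w2) - w1 ^+ 2 + w2 ^+ 2.

Fact digon_relators_const :
  {in [:: digon_rel], forall r, const_term r = 0}.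
Proof.
move=> r; rewrite inE => /eqP ->.
by apply: (rmorph_rel1 (f := mcoeff _)); apply: const_fgen.
Qed.

Definition digon_presentation : presentation k :=
  Presentation digon_level digon_relators_const.

Definition digon_gen (x : 'I_3) : presented_alg digon_presentation :=
  @agen k digon_presentation x.

(* The element r v_12 + s w_1 + t w_2. *)
Definition digon_lin (c : 'rV[k]_3) : presented_alg digon_presentation :=
  \sum_(i < 3) c 0 i *: digon_gen i.

(* [cij] is c_i^j. *)
Definition digon_mx (c11 c21 c12 : k) : 'M[k]_3 :=
  \matrix_(i, j) nth 0 (nth [::]
    [:: [:: c11 + c21; c12 - c21; c21 - c12];
        [:: 0;         c11;       c21];
        [:: 0;         c12;       c11 + c21 - c12]] i) j.

End Digon.

(* Main.v *)
Require Import Defs.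
From HB Require Import structures.
From mathcomp Require Import all_boot all_algebra all_fingroup.
From mathcomp Require Import generic_quotient boolp classical_sets.
From mathcomp Require Import monalg ring.

(** An automorphism preserving both the grading and the filtration is a linear
    map of the span of the generators which is triangular with respect to the
    levels and preserves the space of quadratic relations; conversely every
    such invertible map extends. Compare coefficients in the image of the
    relation 1) attached to [v_{i i+1}]. The part in [v w] forces [v_{i i+1}] to
    go to a multiple of some [v_{s s+1}] plus a combination of the [w_j], and
    [w_i - w_{i+1}] to a multiple of [w_s - w_{s+1}]. The part in [w w] then
    forces the images of [w_i] and [w_{i+1}] into the span of [w_s] and
    [w_{s+1}], with one and the same sum of coefficients [b], and determines the
    [w]-part of the image of [v_{i i+1}]. For [n = 2] this is all, and leaves
    three parameters. For [n >= 3] the image of [w_{i+1}] lies in the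
    intersection of two distinct edges, hence is [b] times a vertex; this gives
    a dihedral permutation, and relation 2) forces [u] to go to [b u]. *)

Set Implicit Arguments.
Unset Strict Implicit.
Unset Printing Implicit Defensive.

Import GRing.Theory.

Local Open Scope ring_scope.

(** * Free and presented algebras *)

Section FreeAlgebra.
Variables (k : fieldType) (X : choiceType).
Implicit Types (a b : free_alg k X) (x y : X).

Lemma free_alg_ind (Q : free_alg k X -> Prop) :
  Q 0 -> (forall a b, Q a -> Q b -> Q (a + b)) ->
  (forall c m, Q << c *g m >>) -> forall a, Q a.
Proof.
by move=> Q0 QD QU a; rewrite [a]monalgE; apply: (big_ind Q) => // m _.
Qed.

(** By bilinearity both factors may be taken to be monomials. If their product is [s], only the cut
    of [s] at the length of the first factor contributes; otherwise no cut does. *)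
Lemma mcoeffM_word (s : seq X) a b :
  mcoeff (FMonom s) (a * b) =
  \sum_(i < (size s).+1)
    mcoeff (FMonom (take i s)) a * mcoeff (FMonom (drop i s)) b.
Proof.
elim/free_alg_ind: a => [|a a' IH IH'|c [m]].
- rewrite mul0r mcoeff0 big1 // => i _; by rewrite mcoeff0 mul0r.
- rewrite mulrDl mcoeffD; apply: etrans (congr2 +%R IH IH') _.
  rewrite -[LHS]big_split; apply: eq_bigr => i _.
  by rewrite mcoeffD mulrDl.
elim/free_alg_ind: b => [|b b' IH IH'|d [m']].
- rewrite mulr0 mcoeff0 big1 // => i _; by rewrite mcoeff0 mulr0.
- rewrite mulrDr mcoeffD; apply: etrans (congr2 +%R IH IH') _.
  rewrite -[LHS]big_split; apply: eq_bigr => i _.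
  by rewrite mcoeffD mulrDr.
rewrite malgM_def fgmulUU mcoeffU fmP fmM /=.
case: eqP => [<-|ne].
  have lt : (size m < (size (m ++ m')).+1)%N by rewrite ltnS size_cat leq_addr.
  rewrite (bigD1 (Ordinal lt)) //= take_size_cat // drop_size_cat //.
  rewrite !mcoeffUU big1 ?addr0 // => i ni.
  rewrite mcoeffU fmP /=; case: eqP => [mE|]; last by rewrite mul0r.
  case/eqP: ni; apply/val_inj => /=; have := congr1 size mE.
  by rewrite size_takel // -ltnS.
rewrite big1 // => i _; rewrite !mcoeffU !fmP /=.
case: eqP => [mE|]; last by rewrite mul0r.
case: eqP => [mE'|]; last by rewrite mulr0.
by case: ne; rewrite mE mE' cat_take_drop.
Qed.

Definition co1 x a : k := mcoeff (FMonom [:: x]) a.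
Definition co2 x y a : k := mcoeff (FMonom [:: x; y]) a.

HB.instance Definition _ x := GRing.Additive.copy (co1 x) (mcoeff (FMonom [:: x])).
HB.instance Definition _ x y :=
  GRing.Additive.copy (co2 x y) (mcoeff (FMonom [:: x; y])).

Lemma const_termE a : mcoeff (FMonom [::]) a = const_term a.
Proof. by congr mcoeff; apply/eqP; rewrite fmP fm1. Qed.

Lemma co1M x a b : co1 x (a * b) = const_term a * co1 x b + co1 x a * const_term b.
Proof.
by rewrite /co1 mcoeffM_word !big_ord_recr big_ord0 /= add0r !const_termE.
Qed.

Lemma co2M x y a b :
  co2 x y (a * b) =
  const_term a * co2 x y b + co1 x a * co1 y b + co2 x y a * const_term b.
Proof.
by rewrite /co2 mcoeffM_word !big_ord_recr big_ord0 /= add0r !const_termE.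
Qed.

Lemma co1Z x c a : co1 x (c *: a) = c * co1 x a.
Proof. exact: mcoeffZ. Qed.

Lemma co1_gen x y : co1 x (fgen y) = (x == y)%:R.
Proof. by rewrite /co1 /fgen mcoeffU fmP fmU /= eqseq_cons andbT eq_sym. Qed.

Lemma const_termM a b : const_term (a * b) = const_term a * const_term b.
Proof. exact: rmorphM. Qed.

Lemma co1_sandwich x a r b :
  const_term r = 0 -> co1 x r = 0 -> co1 x (a * r * b) = 0.
Proof. by move=> r0 r1; rewrite !co1M const_termM r0 r1 !mulr0 addr0 !mul0r addr0. Qed.

(** When [r] has no terms of degree 0 or 1 in the letters concerned, the factors around it reach the
    words of length 2 only through their constant terms. *)
Lemma co2_sandwich x y a r b :
  const_term r = 0 -> co1 x r = 0 -> co1 y r = 0 ->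
  co2 x y (a * r * b) = const_term a * const_term b * co2 x y r.
Proof.
move=> r0 rx ry; rewrite !co2M !co1M const_termM r0 rx ry.
by rewrite !mulr0 !mul0r !addr0 !mul0r !add0r mulrAC.
Qed.

Definition fword (s : seq X) : free_alg k X := \prod_(x <- s) fgen x.

Lemma fwordE s : fword s = << 1 *g FMonom s >>.
Proof.
rewrite /fword; elim: s => [|x s IH]; first by rewrite big_nil -fmoneE.
rewrite big_cons IH malgM_def fgmulUU mulr1; congr << _ *g _ >>.
by apply/eqP; rewrite fmP fmM /= fmuE.
Qed.

Lemma co1_word x s : co1 x (fword s) = ([:: x] == s)%:R.
Proof. by rewrite fwordE /co1 mcoeffU1 fmP /= eq_sym. Qed.

Lemma free_alg_word_ind (Q : free_alg k X -> Prop) :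
  Q 0 -> (forall a b, Q a -> Q b -> Q (a + b)) ->
  (forall c s, Q (c *: fword s)) -> forall a, Q a.
Proof.
move=> Q0 QD QU; apply: free_alg_ind => // c [s].
suff -> : << c *g FMonom s >> = c *: fword s by [].
apply/malgP => m; rewrite fwordE mcoeffZ; apply: etrans (mcoeffU _ _ _) _.
by rewrite mcoeffU1 mulr_natr.
Qed.

Variables (B : algType k) (g : X -> B).

Definition word_val (m : {fmonom X}) : B := \prod_(x <- m) g x.

Fact word_val_mmorphism : mmorphism word_val.
Proof.
by split=> [m m'|]; rewrite /word_val ?fmM ?big_cat // fm1 big_nil.
Qed.
HB.instance Definition _ := isMultiplicative.Build _ _ word_val word_val_mmorphism.

Definition free_hom (a : free_alg k X) : B := mmap (in_alg B) word_val a.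

Fact free_hom_linear : linear free_hom.
Proof.
move=> c a b; rewrite /free_hom raddfD; congr (_ + _).
by apply: (etrans (mmapZ _ _)); rewrite /= -scalerAl mul1r.
Qed.
HB.instance Definition _ :=
  GRing.isLinear.Build k (free_alg k X) B *:%R free_hom free_hom_linear.

Fact free_hom_monoid_morphism : GRing.monoid_morphism free_hom.
Proof.
(* Scalars are central in [B], which is the commutation required for evaluating monomials with
   coefficients. *)
have [|hM h1] := @commr_mmap_is_multiplicative _ _ _ (in_alg B) word_val.
  by move=> a m m'; rewrite /GRing.comm /= -scalerAl -scalerAr mul1r mulr1.
by split=> [|a b]; [exact: h1|exact: hM].
Qed.
HB.instance Definition _ :=
  GRing.isMonoidMorphism.Build (free_alg k X) B free_hom free_hom_monoid_morphism.

Lemma free_hom_gen x : free_hom (fgen x) = g x.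
Proof. by rewrite /free_hom mmapU /word_val fmU big_seq1 /= scale1r mul1r. Qed.

End FreeAlgebra.

Section AutMorphism.
Variables (k : fieldType) (A : algType k) (G F : nat -> classical_sets.set A).
Variable f : Defs.Aut G F.

Fact aut_linear : linear f.
Proof. by have [] := autP f. Qed.
Fact aut_monoid_morphism : GRing.monoid_morphism f.
Proof. by have [] := autP f. Qed.
HB.instance Definition _ := GRing.isLinear.Build k A A *:%R f aut_linear.
HB.instance Definition _ :=
  GRing.isMonoidMorphism.Build A A f aut_monoid_morphism.

End AutMorphism.

(** * Universal property of presented algebras and spans of words *)

Section PresentedAlgebra.
Variables (k : fieldType) (P : presentation k).
Local Notation A := (presented_alg P).
Local Notation F := (free_alg k (gen_type P)).

Fact alg_pi_linear : linear (@alg_pi k P).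
Proof. by move=> c a b; rewrite alg_piD alg_piZ. Qed.
HB.instance Definition _ :=
  GRing.isLinear.Build k F A *:%R (@alg_pi k P) alg_pi_linear.
Fact alg_pi_monoid_morphism : GRing.monoid_morphism (@alg_pi k P).
Proof. by split=> [|a b]; [exact: erefl|exact: alg_piM]. Qed.
HB.instance Definition _ :=
  GRing.isMonoidMorphism.Build F A (@alg_pi k P) alg_pi_monoid_morphism.

Lemma alg_pi_eq0 a : alg_pi a = 0 :> A <-> rel_ideal a.
Proof. by split=> [/alg_piP|ra]; [rewrite subr0|apply/alg_piP; rewrite subr0]. Qed.

Lemma alg_pi_relator r : r \in relators P -> alg_pi r = 0 :> A.
Proof.
move=> rP; apply/alg_pi_eq0; exists [:: (1, r, 1)].
  by move=> t; rewrite inE => /eqP ->.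
by rewrite big_seq1 /= mul1r mulr1.
Qed.

Lemma alg_pi_word s : alg_pi (fword k s) = word s :> A.
Proof. exact: rmorph_prod. Qed.

Lemma presented_ind (Q : A -> Prop) :
  Q 0 -> (forall a b, Q a -> Q b -> Q (a + b)) ->
  (forall c s, Q (c *: word s)) -> forall a, Q a.
Proof.
move=> Q0 QD QU a; rewrite -[a]alg_reprK.
elim/free_alg_word_ind: (repr a) => [|b b' IH IH'|c s].
- exact: Q0.
- by rewrite raddfD; apply: QD.
- by rewrite linearZ /= alg_pi_word; apply: QU.
Qed.

(** Universal property: evaluation on the free algebra kills the ideal of the relators, so it can be
    computed on any representative; [h] uses the one given by [repr]. *)
Lemma presented_hom (B : algType k) (g : gen_type P -> B) :
  {in relators P, forall r, free_hom g r = 0} ->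
  exists h : {lrmorphism A -> B}, forall x, h (agen x) = g x.
Proof.
move=> gr; have g0 a : rel_ideal a -> free_hom g a = 0.
  move=> [s sP ->]; rewrite raddf_sum big_seq big1 // => t /sP tP.
  by rewrite /= !rmorphM /= (gr _ tP) mulr0 mul0r.
pose h (a : A) := free_hom g (repr a).
have hE a : h (alg_pi a) = free_hom g a.
  by apply/eqP; rewrite -subr_eq0 -raddfB /=; apply/eqP/g0/alg_reprP.
have hl : linear h.
  move=> c a b; rewrite -[a]alg_reprK -[b]alg_reprK -linearP.
  by rewrite !(hE, alg_reprK) linearP.
have hm : GRing.monoid_morphism h.
  split=> [|a b]; first by rewrite -(rmorph1 (@alg_pi k P)) hE rmorph1.
  by rewrite -[a]alg_reprK -[b]alg_reprK -rmorphM !(hE, alg_reprK) rmorphM.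
pose hL := GRing.isLinear.Build k A B *:%R h hl.
pose hM := GRing.isMonoidMorphism.Build A B h hm.
pose hh : {lrmorphism A -> B} := HB.pack h hL hM.
by exists hh => x; rewrite /= /agen hE free_hom_gen.
Qed.

Lemma lrmorphism_eq (B : algType k) (h h' : {lrmorphism A -> B}) :
  (forall x, h (agen x) = h' (agen x)) -> h =1 h'.
Proof.
move=> hh'; apply: presented_ind => [|a b IH IH'|c s].
- by rewrite !raddf0.
- by rewrite !raddfD /= IH IH'.
- rewrite !linearZ /word /= !rmorph_prod; congr (_ *: _).
  by apply: eq_bigr => x _; apply: hh'.
Qed.

Section WordSpan.
Implicit Types p q r : pred (seq (gen_type P)).

Lemma word_span0 p : word_span p (0 : A).
Proof. by exists [::]; rewrite ?big_nil. Qed.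

Lemma word_spanD p (a b : A) : word_span p a -> word_span p b -> word_span p (a + b).
Proof.
move=> [c cP ->] [d dP ->]; exists (c ++ d); last by rewrite big_cat.
by move=> t; rewrite mem_cat => /orP[/cP|/dP].
Qed.

Lemma word_spanZ p c (a : A) : word_span p a -> word_span p (c *: a).
Proof.
move=> [d dP ->]; exists [seq (c * t.1, t.2) | t <- d].
  by move=> _ /mapP[t /dP tP ->].
by rewrite big_map scaler_sumr; apply: eq_bigr => t _; rewrite scalerA.
Qed.

Lemma word_span_word p s : p s -> word_span p (word s : A).
Proof.
move=> ps; exists [:: (1, s)]; first by move=> t; rewrite inE => /eqP ->.
by rewrite big_seq1 scale1r.
Qed.

Lemma word_span_sum p (I : Type) (e : seq I) (E : I -> A) :
  (forall i, word_span p (E i)) -> word_span p (\sum_(i <- e) E i).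
Proof. by move=> pE; apply: big_ind => *; [exact: word_span0|exact: word_spanD|]. Qed.

Lemma word_spanM p q r (a b : A) :
  (forall s t, p s -> q t -> r (s ++ t)) ->
  word_span p a -> word_span q b -> word_span r (a * b).
Proof.
move=> pqr [c cP ->] [d dP ->]; rewrite mulr_suml big_seq.
apply: big_ind => [||t tc]; [exact: word_span0|exact: word_spanD|].
rewrite mulr_sumr big_seq.
apply: big_ind => [||t' tc']; [exact: word_span0|exact: word_spanD|].
rewrite -scalerAl -scalerAr; do 2![apply: word_spanZ].
rewrite /word -big_cat; apply: word_span_word.
by apply: pqr; [exact: cP|exact: dP].
Qed.

Lemma word_span_sub p q (a : A) :
  (forall s, p s -> q s) -> word_span p a -> word_span q a.
Proof. by move=> pq [c cP ->]; exists c => // t /cP /pq. Qed.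

End WordSpan.

Lemma weight_cons x (s : seq (gen_type P)) : weight (x :: s) = (level x + weight s)%N.
Proof. by rewrite /weight big_cons. Qed.

Lemma weight_cat (s t : seq (gen_type P)) : weight (s ++ t) = (weight s + weight t)%N.
Proof. by rewrite /weight big_cat. Qed.

(** Encoded through one-letter words so that the rules for [word_span] apply. For quadratic relators
    this is the intersection of A_[1] with A_(l). *)
Definition lin_part (l : nat) : classical_sets.set A :=
  word_span (fun s => (size s == 1%N) && (weight s <= l)%N).

Lemma lin_part_gen l x : (level x <= l)%N -> lin_part l (agen x).
Proof.
move=> xl; have -> : agen x = word [:: x] by rewrite /word big_seq1.
by apply: word_span_word; rewrite /= weight_cons /weight big_nil addn0.
Qed.

(** If generators go to combinations of generators of no higher level, a word goes to words of the
    same length and no larger weight. Thus [h] and [h'] map every graded and every filtered part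
    into itself, and being mutually inverse they map it onto itself. *)
Lemma gf_aut_lin (h h' : {lrmorphism A -> A}) :
  (forall x, h (h' (agen x)) = agen x) -> (forall x, h' (h (agen x)) = agen x) ->
  (forall x, lin_part (level x) (h (agen x))) ->
  (forall x, lin_part (level x) (h' (agen x))) ->
  gf_aut (@graded_part _ P) (@filtered_part _ P) h.
Proof.
move=> hh' h'h hl h'l.
have hK : cancel h h' by apply: (@lrmorphism_eq A (h' \o h) idfun).
have h'K : cancel h' h by apply: (@lrmorphism_eq A (h \o h') idfun).
have wordP (f : {lrmorphism A -> A}) (s : seq (gen_type P)) :
    (forall x, lin_part (level x) (f (agen x))) ->
    word_span (fun t => (size t == size s) && (weight t <= weight s)%N) (f (word s)).
  move=> fl; elim: s => [|x s IH].
    by rewrite /word big_nil rmorph1 -(big_nil _ _ _ _ : word [::] = 1);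
       apply: word_span_word; rewrite eqxx leqnn.
  rewrite /word big_cons rmorphM; apply: word_spanM (fl x) IH.
  move=> t t' /andP[/eqP st wt] /andP[/eqP st' wt'].
  by rewrite size_cat st st' eqxx weight_cat weight_cons leq_add.
have sub (f : {lrmorphism A -> A}) (p : pred (seq (gen_type P))) :
    (forall x, lin_part (level x) (f (agen x))) ->
    (forall s t, p s -> size t = size s -> (weight t <= weight s)%N -> p t) ->
    forall a, word_span p a -> word_span p (f a).
  move=> fl pP a [c cP ->]; rewrite raddf_sum big_seq.
  apply: big_ind => [||t tc]; [exact: word_span0|exact: word_spanD|].
  rewrite /= linearZ; apply: word_spanZ; apply: word_span_sub (wordP _ t.2 fl) => s.
  by move=> /andP[/eqP ss ws]; apply: pP ss ws; apply: cP.
have im (p : pred (seq (gen_type P))) :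
    (forall s t, p s -> size t = size s -> (weight t <= weight s)%N -> p t) ->
    (h @` word_span p = word_span p)%classic.
  move=> pP; apply/seteqP; split=> [_ [a pa <-]|a pa]; first exact: sub.
  by exists (h' a); rewrite ?h'K //; apply: sub.
split.
- exact: linearP.
- by split; [exact: rmorph1|exact: rmorphM].
- exact: Bijective hK h'K.
- by move=> i; apply: im => s t ps ->.
- by move=> i; apply: im => s t ps _ /leq_trans; apply.
Qed.

Lemma aut_eq (phi psi : AutGF P) :
  (forall x, phi (agen x) = psi (agen x)) -> phi = psi.
Proof. by move=> e; apply/val_inj/funext; exact: (@lrmorphism_eq A phi psi). Qed.

End PresentedAlgebra.

(** * Relators without linear part *)

Section FiniteQuadratic.
Variables (k : fieldType) (X : finType) (lev : X -> nat).
Variables (rels : seq (free_alg k X)).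
Hypothesis rels0 : {in rels, forall r, const_term r = 0}.
Hypothesis rels1 : {in rels, forall r x, co1 x r = 0}.
Let P := Presentation lev rels0.
Local Notation A := (presented_alg P).

Lemma rel_ideal_co1 a x : @rel_ideal k P a -> co1 x a = 0.
Proof.
move=> [s sP ->]; rewrite raddf_sum big_seq big1 // => t /sP tP.
exact: co1_sandwich (rels0 tP) (rels1 tP x).
Qed.

(** In degree 2 the ideal is just the linear span of the relators; the scalars are the products of
    the constant terms of the outer factors. *)
Lemma rel_ideal_co2 a : @rel_ideal k P a ->
  exists2 s : seq (k * free_alg k X), {in s, forall t, t.2 \in rels} &
    forall x y, co2 x y a = \sum_(t <- s) t.1 * co2 x y t.2.
Proof.
move=> [s sP ->].
exists [seq (const_term t.1.1 * const_term t.2, t.1.2) | t <- s].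
  by move=> _ /mapP[t /sP tP ->].
move=> x y; rewrite raddf_sum big_map big_seq [RHS]big_seq.
apply: eq_bigr => t /sP tP /=.
exact: co2_sandwich (rels0 tP) (rels1 tP x) (rels1 tP y).
Qed.

Definition flin (c : X -> k) : free_alg k X := \sum_x c x *: fgen x.
Definition alin (c : X -> k) : A := \sum_x c x *: @agen k P x.

Lemma alg_pi_flin c : @alg_pi k P (flin c) = alin c.
Proof.
by rewrite raddf_sum; apply: eq_bigr => x _; apply: (@alg_piZ k P).
Qed.

Lemma const_flin c : const_term (flin c) = 0.
Proof.
rewrite /const_term raddf_sum big1 // => x _.
by rewrite /= mcoeffZ [X in _ * X]const_fgen mulr0.
Qed.

Lemma co1_flin c x : co1 x (flin c) = c x.
Proof.
rewrite (raddf_sum (co1 x)) (eq_bigr (fun y => c y * (x == y)%:R)); last first.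
  by move=> y _; rewrite /= co1Z co1_gen.
rewrite (bigD1 x) //= eqxx mulr1 big1 ?addr0 // => y.
by rewrite eq_sym => /negPf ->; rewrite mulr0.
Qed.

(** The generators stay linearly independent in the quotient, because no element of the ideal has a
    linear part. *)
Lemma alin_inj c d : alin c = alin d -> c =1 d.
Proof.
rewrite -!alg_pi_flin => /alg_piP /rel_ideal_co1 cd x; apply/eqP.
by rewrite -subr_eq0 -(co1_flin c) -(co1_flin d) -raddfB /= cd.
Qed.

Lemma alin_delta x : @agen k P x = alin (fun y => (x == y)%:R).
Proof.
rewrite /alin (bigD1 x) //= eqxx scale1r big1 ?addr0 // => y yx.
by rewrite eq_sym (negPf yx) scale0r.
Qed.

Lemma linear_alin (V : lmodType k) (f : {linear A -> V}) c :
  f (alin c) = \sum_x c x *: f (@agen k P x).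
Proof. by rewrite raddf_sum; apply: eq_bigr => x _; apply: linearZZ. Qed.

Lemma alin_lin_part l c :
  (forall x, c x != 0 -> (lev x <= l)%N) -> @lin_part k P l (alin c).
Proof.
move=> cl; apply: word_span_sum => x; have [->|/cl xl] := eqVneq (c x) 0.
  by rewrite scale0r; apply: word_span0.
exact/word_spanZ/lin_part_gen.
Qed.

(** Degree 1 provides a linear form, the filtration an expression in words of weight at most [l].
    Their difference lies in the ideal, which has no linear part, so a generator with nonzero
    coefficient must occur as a one-letter word of the second expression. *)
Lemma gf_alin l a : @graded_part k P 1 a -> @filtered_part k P l a ->
  exists2 c : X -> k, a = alin c & forall x, c x != 0 -> (lev x <= l)%N.
Proof.
move=> [s sP aE] [t tP aE'].
have [c aEc] : exists c, a = alin c.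
  rewrite aE; elim: s sP {aE} => [|[d w] s IH] sP.
    by exists (fun=> 0); rewrite big_nil /alin big1 // => x _; rewrite scale0r.
  have [|c cE] := IH; first by move=> u us; apply: sP; rewrite inE us orbT.
  have := sP _ (mem_head _ _); case: w {sP} => [|x [|]] //= _.
  exists (fun y => d * (x == y)%:R + c y); rewrite big_cons cE /=.
  rewrite /word big_seq1 [X in d *: X]alin_delta scaler_sumr -big_split.
  by apply: eq_bigr => y _; rewrite scalerA scalerDl.
exists c => // x; apply: contraNT; rewrite -ltnNge => lx.
have : @rel_ideal k P (flin c - \sum_(u <- t) u.1 *: fword k u.2).
  apply/alg_piP; rewrite alg_pi_flin -aEc aE' raddf_sum.
  by apply: eq_bigr => u _; rewrite /= linearZ /= alg_pi_word.
move=> /rel_ideal_co1 -/(_ x); rewrite raddfB /= co1_flin => /eqP.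
rewrite subr_eq0 => /eqP ->; rewrite raddf_sum big_seq big1 // => u /tP ut.
rewrite /= co1Z co1_word; case: eqP => [xu|]; last by rewrite mulr0.
by move: ut; rewrite -xu weight_cons /weight big_nil addn0 leqNgt /= lx.
Qed.

Lemma graded_gen x : @graded_part k P 1 (@agen k P x).
Proof. by apply: word_span_sub (lin_part_gen (leqnn _)) => s /andP[]. Qed.

Lemma filtered_gen x : @filtered_part k P (lev x) (@agen k P x).
Proof. by apply: word_span_sub (lin_part_gen (leqnn _)) => s /andP[]. Qed.

Lemma aut_alin (phi : AutGF P) : exists2 m : X -> X -> k,
  forall x, phi (@agen k P x) = alin (m x) & forall x y, m x y != 0 -> (lev y <= lev x)%N.
Proof.
have [_ _ _ phiG phiF] := autP phi.
have ex x : exists c, phi (@agen k P x) = alin c /\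
    forall y, c y != 0 -> (lev y <= lev x)%N.
  have [||c cE cl] := @gf_alin (lev x) (phi (@agen k P x)); last by exists c.
    by rewrite -phiG; exists (@agen k P x) => //; apply: graded_gen.
  by rewrite -phiF; exists (@agen k P x) => //; apply: filtered_gen.
have [m mP] := choice ex.
by exists m => [x|x y]; have [mE ml] := mP x; [exact: mE|exact: ml].
Qed.

Lemma aut_alin_inv (phi : AutGF P) : exists m m' : X -> X -> k,
  [/\ forall x, phi (@agen k P x) = alin (m x),
      forall x y, m x y != 0 -> (lev y <= lev x)%N,
      forall x y, m' x y != 0 -> (lev y <= lev x)%N
    & forall x z, \sum_y m x y * m' y z = (x == z)%:R].
Proof.
have [m mE ml] := aut_alin phi; have [m' mE' ml'] := aut_alin (phi^-1)%g.
exists m, m'; split=> // x z; move: z; apply: alin_inj; rewrite -alin_delta.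
have -> : @agen k P x = (phi^-1)%g (phi (@agen k P x)).
  by have /(congr1 (fun f : AutGF P => f (@agen k P x))) := mulgV phi.
rewrite mE; apply: etrans (esym (linear_alin _ _)).
rewrite -[RHS](eq_bigr _ (fun y _ => congr1 (GRing.scale (m x y)) (esym (mE' y)))).
rewrite /alin; under [RHS]eq_bigr => y _ do rewrite scaler_sumr.
rewrite exchange_big; apply: eq_bigr => z _; rewrite scaler_suml.
by apply: eq_bigr => y _; rewrite scalerA.
Qed.

End FiniteQuadratic.

(* [e], [f1], [f1'], [f2] stand for the constant term and the coefficients on
   words of length 1 and 2; an abstract ring keeps the multiplication of
   [free_alg] from being unfolded. *)
Section CoefficientFormulas.
Variables (k : fieldType) (R : nzRingType) (e : {rmorphism R -> k}).
Variables f1 f1' f2 : {additive R -> k}.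
Hypothesis f1M : forall a b, f1 (a * b) = e a * f1 b + f1 a * e b.
Hypothesis f2M : forall a b, f2 (a * b) = e a * f2 b + f1 a * f1' b + f2 a * e b.
Variables a b c d : R.
Hypotheses (a0 : e a = 0) (b0 : e b = 0) (c0 : e c = 0) (d0 : e d = 0).

Let bc0 : e (b - c) = 0.
Proof. by rewrite rmorphB b0 c0 subrr. Qed.

Lemma linear_coef_form1 : f1 (a * (b - c) - b ^+ 2 + c ^+ 2) = 0.
Proof.
rewrite !raddfD raddfN /= !expr2 !f1M a0 b0 c0 bc0.
by rewrite !mulr0 !mul0r !addr0 oppr0 ?addr0.
Qed.

Lemma linear_coef_form2 :
  f1 (a * (b - c) - b ^+ 2 + c ^+ 2 + (b - c) * d) = 0.
Proof. by rewrite raddfD /= linear_coef_form1 f1M bc0 d0 mulr0 mul0r !addr0. Qed.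

Let f2M_lin u v : e u = 0 -> e v = 0 -> f2 (u * v) = f1 u * f1' v.
Proof. by move=> u0 v0; rewrite f2M u0 v0 mulr0 mul0r addr0 add0r. Qed.

Lemma quadratic_coef_form1 :
  f2 (a * (b - c) - b ^+ 2 + c ^+ 2) =
  f1 a * (f1' b - f1' c) - f1 b * f1' b + f1 c * f1' c.
Proof. by rewrite !raddfD raddfN /= !expr2 !f2M_lin // raddfB. Qed.

Lemma quadratic_coef_form2 :
  f2 (a * (b - c) - b ^+ 2 + c ^+ 2 + (b - c) * d) =
  f1 a * (f1' b - f1' c) - f1 b * f1' b + f1 c * f1' c + (f1 b - f1 c) * f1' d.
Proof. by rewrite raddfD /= quadratic_coef_form1 f2M_lin // raddfB. Qed.

End CoefficientFormulas.

Section FreeCoefficientFormulas.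
Variables (k : fieldType) (X : choiceType) (x y : X) (a b c d : free_alg k X).
Hypotheses (a0 : const_term a = 0) (b0 : const_term b = 0).
Hypotheses (c0 : const_term c = 0) (d0 : const_term d = 0).

Lemma co1_form1 : co1 x (a * (b - c) - b ^+ 2 + c ^+ 2) = 0.
Proof. exact: (linear_coef_form1 (e := @mcoeff {fmonom X} k mone) (co1M x)). Qed.

Lemma co1_form2 : co1 x (a * (b - c) - b ^+ 2 + c ^+ 2 + (b - c) * d) = 0.
Proof. exact: (linear_coef_form2 (e := @mcoeff {fmonom X} k mone) (co1M x)). Qed.

Lemma co2_form1 :
  co2 x y (a * (b - c) - b ^+ 2 + c ^+ 2) =
  co1 x a * (co1 y b - co1 y c) - co1 x b * co1 y b + co1 x c * co1 y c.
Proof. exact: (quadratic_coef_form1 (e := @mcoeff {fmonom X} k mone) (co2M x y)). Qed.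

Lemma co2_form2 :
  co2 x y (a * (b - c) - b ^+ 2 + c ^+ 2 + (b - c) * d) =
  co1 x a * (co1 y b - co1 y c) - co1 x b * co1 y b + co1 x c * co1 y c
  + (co1 x b - co1 x c) * co1 y d.
Proof. exact: (quadratic_coef_form2 (e := @mcoeff {fmonom X} k mone) (co2M x y)). Qed.

End FreeCoefficientFormulas.

(** * The polygon *)

Section CyclicOrder.
Variable n : nat.
Implicit Types i j : 'I_n.

Lemma ordS_neq i : (1 < n)%N -> ordS i != i.
Proof.
move=> n1; rewrite -val_eqE /=; have := ltn_ord i.
rewrite leq_eqVlt => /orP[/eqP iE|lt]; last by rewrite modn_small // gtn_eqF.
by rewrite iE modnn; apply: contraTneq n1 => i0; rewrite -iE -i0.
Qed.

Lemma ordSS_neq i : (2 < n)%N -> ordS (ordS i) != i.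
Proof.
move=> n2; rewrite -val_eqE /=; have [lt|ge] := ltnP i.+2 n.
  by rewrite (modn_small (ltnW lt)) modn_small // gtn_eqF.
have := ltn_ord i; rewrite leq_eqVlt => /orP[/eqP iE|lt].
  rewrite iE modnn modn_small ?(ltn_trans _ n2) //.
  by apply: contraTneq n2 => i1; rewrite -iE -i1.
have iE : i.+2 = n by apply/eqP; rewrite eqn_leq lt ge.
rewrite (modn_small lt) iE modnn.
by apply: contraTneq n2 => i0; rewrite -iE -i0.
Qed.

Lemma eq_ordS i j : (i == ordS j) = (ord_pred i == j).
Proof. by rewrite -{1}[i]ord_predK (inj_eq (@ordS_inj n)). Qed.

Lemma ordS_const (T : Type) (f : 'I_n -> T) :
  (forall i, f (ordS i) = f i) -> forall i j, f i = f j.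
Proof.
move=> fS i j; have it m l : f (iter m (@ordS n) l) = f l.
  by elim: m => //= m IH; rewrite fS.
(* The count [n - i + j] stays within the natural numbers whatever the order of [i] and [j]; it
   leads from [i] to [n + j], which is [j] modulo [n]. *)
suff -> : j = iter (n - i + j) (@ordS n) i by rewrite it.
apply/ord_inj; rewrite val_iter_ordS addnA subnKC ?(ltnW (ltn_ord i)) //.
by rewrite modnDl modn_small.
Qed.

End CyclicOrder.

Section DeltaSums.
Variables (k : fieldType) (n : nat).
Implicit Types (c : 'I_n -> k) (j : 'I_n).

Lemma sum_delta c j : \sum_i c i * (j == i)%:R = c j.
Proof.
rewrite (bigD1 j) //= eqxx mulr1 big1 ?addr0 // => i.
by rewrite eq_sym => /negPf ->; rewrite mulr0.
Qed.

Lemma sum_delta_ordS c j : \sum_i c i * (j == ordS i)%:R = c (ord_pred j).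
Proof.
by rewrite -[RHS]sum_delta; apply: eq_bigr => i _; rewrite eq_ordS.
Qed.

Lemma sum_delta2 c p q : \sum_i c i * ((p == i)%:R * (q == i)%:R) = (p == q)%:R * c p.
Proof.
under eq_bigr => i _ do rewrite mulrA.
rewrite (sum_delta (fun i => c i * (p == i)%:R)).
by have [->|_] := eqVneq p q; [rewrite mulrC|rewrite mulr0 mul0r].
Qed.

Lemma sum_delta2_ordS c p q :
  \sum_i c i * ((p == ordS i)%:R * (q == ordS i)%:R) = (p == q)%:R * c (ord_pred p).
Proof.
rewrite -(inj_eq (can_inj (@ord_predK n))) -sum_delta2.
by apply: eq_bigr => i _; rewrite !eq_ordS.
Qed.

End DeltaSums.

(** Replaces a list of relators, possibly with repetitions, by one coefficient per index in each
    family. The parameter [z] lets the same coefficients serve all words of length 2 at once. *)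
Lemma span_cat_images (k : nzRingType) (I : finType) (T : eqType) (Z : Type)
    (r1 r2 : I -> T) (q : Z -> T -> k) (s : seq (k * T)) :
  {in s, forall t, t.2 \in [seq r1 i | i <- enum I] ++ [seq r2 i | i <- enum I]} ->
  exists c1 c2 : I -> k, forall z, \sum_(t <- s) t.1 * q z t.2 =
    \sum_i c1 i * q z (r1 i) + \sum_i c2 i * q z (r2 i).
Proof.
have add (c : I -> k) (d : k) i (r : I -> T) z :
    \sum_j (d * (i == j)%:R + c j) * q z (r j) =
    d * q z (r i) + \sum_j c j * q z (r j).
  under eq_bigr => j _ do rewrite mulrDl.
  rewrite big_split /=; congr (_ + _).
  rewrite (bigD1 i) //= eqxx mulr1 big1 ?addr0 // => j.
  by rewrite eq_sym => /negPf ->; rewrite mulr0 mul0r.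
elim: s => [|[d r] s IH] sP.
  exists (fun=> 0), (fun=> 0) => z; rewrite big_nil.
  by rewrite !big1 ?addr0 // => i _; rewrite mul0r.
have [|c1 [c2 cE]] := IH; first by move=> u us; apply: sP; rewrite inE us orbT.
have := sP _ (mem_head _ _); rewrite mem_cat => /orP[] /mapP[i _ /= ->].
  exists (fun j => d * (i == j)%:R + c1 j), c2 => z.
  by rewrite big_cons cE add addrA.
exists c1, (fun j => d * (i == j)%:R + c2 j) => z.
by rewrite big_cons cE add addrCA.
Qed.

(** * Quadratic part of the relation ideal of the polygon *)

Section PolygonCoefficients.
Variables (n : nat) (k : fieldType).
Local Notation PP := (polygon_presentation n k).
Implicit Types (a : free_alg k (gen n)).

Lemma gen_eqE : ((forall i j : 'I_n, (gV i == gV j) = (i == j)) *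
  (forall i j : 'I_n, (gW i == gW j) = (i == j)) *
  (forall i : 'I_n, (gU == gV i) = false) * (forall i : 'I_n, (gU == gW i) = false) *
  (forall i : 'I_n, (gV i == gU) = false) * (forall i : 'I_n, (gW i == gU) = false) *
  (forall i j : 'I_n, (gV i == gW j) = false) *
  (forall i j : 'I_n, (gW i == gV j) = false))%type.
Proof. by do !split. Qed.

Lemma polygon_rels1 : {in polygon_relators n k, forall r x, co1 x r = 0}.
Proof.
move=> r; rewrite mem_cat => /orP[] /mapP[i _ ->] x.
  by apply: co1_form1; apply: const_fgen.
by apply: co1_form2; apply: const_fgen.
Qed.

Definition rel_comb (c1 c2 : 'I_n -> k) (x y : gen n) : k :=
  \sum_i c1 i * co2 x y (polygon_rel1 k i) + \sum_i c2 i * co2 x y (polygon_rel2 k i).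

Lemma polygon_rel_ideal_co2 (a : free_alg k (gen n)) : @rel_ideal k PP a ->
  exists c1 c2 : 'I_n -> k, forall x y, co2 x y a = rel_comb c1 c2 x y.
Proof.
move=> /(rel_ideal_co2 polygon_rels1)[s sP aE].
have [c1 [c2 cE]] := span_cat_images (fun z => co2 z.1 z.2) sP.
by exists c1, c2 => x y; rewrite aE (cE (x, y)).
Qed.

Lemma rel_combE c1 c2 x y : rel_comb c1 c2 x y =
  \sum_i c1 i * ((x == gV i)%:R * ((y == gW i)%:R - (y == gW (ordS i))%:R)
     - (x == gW i)%:R * (y == gW i)%:R + (x == gW (ordS i))%:R * (y == gW (ordS i))%:R) +
  \sum_i c2 i * ((x == gU)%:R * ((y == gV i)%:R - (y == gV (ordS i))%:R)
     - (x == gV i)%:R * (y == gV i)%:R + (x == gV (ordS i))%:R * (y == gV (ordS i))%:R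
     + ((x == gV i)%:R - (x == gV (ordS i))%:R) * (y == gW (ordS i))%:R).
Proof.
congr (_ + _); apply: eq_bigr => i _; congr (_ * _).
  by rewrite co2_form1 ?const_fgen // !co1_gen.
by rewrite co2_form2 ?const_fgen // !co1_gen.
Qed.

Lemma rel_comb_UV c1 c2 j : rel_comb c1 c2 gU (gV j) = c2 j - c2 (ord_pred j).
Proof.
rewrite rel_combE big1 ?add0r => [|i _]; last by rewrite !gen_eqE ?mulr0n; ring.
rewrite -(sum_delta c2) -sum_delta_ordS -sumrB; apply: eq_bigr => i _.
by rewrite !gen_eqE eqxx ?(mulr0n, mulr1n); ring.
Qed.

Lemma rel_comb_WV c1 c2 p q : rel_comb c1 c2 (gW p) (gV q) = 0.
Proof. by rewrite rel_combE !big1 ?addr0 // => i _; rewrite !gen_eqE ?mulr0n; ring. Qed.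

Lemma rel_comb_VV c1 c2 p q :
  rel_comb c1 c2 (gV p) (gV q) = (p == q)%:R * (c2 (ord_pred p) - c2 p).
Proof.
rewrite rel_combE big1 ?add0r => [|i _]; last by rewrite !gen_eqE ?mulr0n; ring.
rewrite mulrBr -(sum_delta2 c2) -sum_delta2_ordS -sumrB; apply: eq_bigr => i _.
by rewrite !gen_eqE ?mulr0n; ring.
Qed.

Lemma rel_comb_WW c1 c2 p q :
  rel_comb c1 c2 (gW p) (gW q) = (p == q)%:R * (c1 (ord_pred p) - c1 p).
Proof.
rewrite rel_combE [X in _ + X]big1 ?addr0 => [|i _]; last by rewrite !gen_eqE ?mulr0n; ring.
rewrite mulrBr -(sum_delta2 c1) -sum_delta2_ordS -sumrB; apply: eq_bigr => i _.
by rewrite !gen_eqE ?mulr0n; ring.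
Qed.

(** Words of this kind are the only ones met by both families: [v_j w_l] occurs in relation 1) of
    the edge [j], and in the relation 2) whose last factor is [w_l], which has the predecessor of
    [l] as its index. *)
Lemma rel_comb_VW c1 c2 j l : rel_comb c1 c2 (gV j) (gW l) =
  c1 j * ((l == j)%:R - (l == ordS j)%:R)
  + c2 (ord_pred l) * ((l == ordS j)%:R - (l == j)%:R).
Proof.
rewrite rel_combE; congr (_ + _).
  rewrite -(sum_delta (fun i => c1 i * ((l == i)%:R - (l == ordS i)%:R))).
  by apply: eq_bigr => i _; rewrite !gen_eqE ?mulr0n; ring.
transitivity (c2 (ord_pred l) * ((j == ord_pred l)%:R - (j == ordS (ord_pred l))%:R)).
  rewrite -(sum_delta_ordS (fun i => c2 i * ((j == i)%:R - (j == ordS i)%:R))).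
  by apply: eq_bigr => i _; rewrite !gen_eqE ?mulr0n; ring.
by rewrite ord_predK [j == ord_pred l]eq_sym -eq_ordS [j == l]eq_sym.
Qed.
End PolygonCoefficients.

Section MorphismForms.
Variables (R S : nzRingType) (f : {rmorphism R -> S}) (a b c d : R).

Lemma rmorph_form1 : f (a * (b - c) - b ^+ 2 + c ^+ 2) =
  f a * (f b - f c) - f b ^+ 2 + f c ^+ 2.
Proof. by rewrite rmorphD rmorphB rmorphM rmorphB !rmorphXn. Qed.

Lemma rmorph_form2 : f (a * (b - c) - b ^+ 2 + c ^+ 2 + (b - c) * d) =
  f a * (f b - f c) - f b ^+ 2 + f c ^+ 2 + (f b - f c) * f d.
Proof. by rewrite rmorphD rmorph_form1 rmorphM rmorphB. Qed.

End MorphismForms.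

Section LinearFormCoefficients.
Variables (k : fieldType) (X : finType) (x y : X) (a b c d : X -> k).

Lemma co2_form1_flin :
  co2 x y (flin a * (flin b - flin c) - flin b ^+ 2 + flin c ^+ 2) =
  a x * (b y - c y) - b x * b y + c x * c y.
Proof.
apply: etrans (co2_form1 x y (const_flin a) (const_flin b) (const_flin c)) _.
by congr (_ * (_ - _) - _ * _ + _ * _); apply: co1_flin.
Qed.

Lemma co2_form2_flin :
  co2 x y (flin a * (flin b - flin c) - flin b ^+ 2 + flin c ^+ 2 +
    (flin b - flin c) * flin d) =
  a x * (b y - c y) - b x * b y + c x * c y + (b x - c x) * d y.
Proof.
apply: etrans (co2_form2 x y (const_flin a) (const_flin b) (const_flin c)
  (const_flin d)) _.
by congr (_ * (_ - _) - _ * _ + _ * _ + (_ - _) * _); apply: co1_flin.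
Qed.

End LinearFormCoefficients.

(** * Coefficient equations for images of the relations *)

Section PolygonRelations.
Variables (n : nat) (k : fieldType).
Local Notation PP := (polygon_presentation n k).
Local Notation L := (@alin k (gen n) (@gen_level n) (polygon_relators n k)
  (@polygon_relators_const n k)).
Implicit Types a b c d : gen n -> k.

(* Since [u] does not occur, the coefficients of the relators 2) are all equal;
   as the sum of the relators 1) and 2) vanishes, one may take them to be 0. *)
Lemma polygon_form1_coefs a b c :
  a gU = 0 -> b gU = 0 -> c gU = 0 ->
  (forall j, b (gV j) = 0) -> (forall j, c (gV j) = 0) ->
  L a * (L b - L c) - L b ^+ 2 + L c ^+ 2 = 0 ->
  exists la : 'I_n -> k,
    (forall j l, a (gV j) * (b (gW l) - c (gW l)) =
       la j * ((l == j)%:R - (l == ordS j)%:R)) /\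
    (forall p q, a (gW p) * (b (gW q) - c (gW q)) - b (gW p) * b (gW q) +
       c (gW p) * c (gW q) = (p == q)%:R * (la (ord_pred p) - la p)).
Proof.
move=> aU bU cU bV cV.
rewrite -!(alg_pi_flin (@gen_level n) (@polygon_relators_const n k)) => rel.
have /(alg_pi_eq0 (P := PP))/polygon_rel_ideal_co2[c1 [c2 cE]] :=
  etrans (rmorph_form1 (@alg_pi k PP) (flin a) (flin b) (flin c)) rel.
have coefE x y : a x * (b y - c y) - b x * b y + c x * c y = rel_comb c1 c2 x y.
  by rewrite -cE co2_form1_flin.
have c2S j : c2 (ordS j) = c2 j.
  have := coefE gU (gV (ordS j)); rewrite rel_comb_UV ordSK aU bU cU !mul0r subrr add0r.
  by move/eqP; rewrite eq_sym subr_eq0 => /eqP.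
exists (fun j => c1 j - c2 j); split=> [j l|p q].
  have := coefE (gV j) (gW l); rewrite bV cV !mul0r subr0 addr0 => ->.
  by rewrite rel_comb_VW (ordS_const c2S (ord_pred l) j); ring.
by rewrite coefE rel_comb_WW (ordS_const c2S (ord_pred p) p); ring.
Qed.

(** The relators 1) contain no word of the forms [u v], [v v] or [w v], so on these words only the
    coefficients [mu] of the relators 2) are seen. *)
Lemma polygon_form2_coefs a b c d :
  b gU = 0 -> c gU = 0 ->
  (forall j, b (gW j) = 0) -> (forall j, c (gW j) = 0) -> (forall j, d (gV j) = 0) ->
  L a * (L b - L c) - L b ^+ 2 + L c ^+ 2 + (L b - L c) * L d = 0 ->
  exists mu : 'I_n -> k,
  [/\ forall j, a gU * (b (gV j) - c (gV j)) = mu j - mu (ord_pred j),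
      forall p q, a (gV p) * (b (gV q) - c (gV q)) - b (gV p) * b (gV q) +
        c (gV p) * c (gV q) = (p == q)%:R * (mu (ord_pred p) - mu p)
    & forall p q, a (gW p) * (b (gV q) - c (gV q)) = 0].
Proof.
move=> bU cU bW cW dV.
rewrite -!(alg_pi_flin (@gen_level n) (@polygon_relators_const n k)) => rel.
have /(alg_pi_eq0 (P := PP))/polygon_rel_ideal_co2[c1 [c2 cE]] :=
  etrans (rmorph_form2 (@alg_pi k PP) (flin a) (flin b) (flin c) (flin d)) rel.
have coefE x y : a x * (b y - c y) - b x * b y + c x * c y + (b x - c x) * d y
    = rel_comb c1 c2 x y.
  by rewrite -cE co2_form2_flin.
exists c2; split=> [j|p q|p q].
- by rewrite -(rel_comb_UV c1) -coefE bU cU; ring.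
- by rewrite -(rel_comb_VV c1) -coefE dV; ring.
- by have := coefE (gW p) (gV q); rewrite rel_comb_WV bW cW dV => <-; ring.
Qed.

End PolygonRelations.

(** * Solving the equations of a single edge *)

Section Edges.
Variable k : fieldType.

(* [x, x'] and [y, y'] are the coefficients of the images of [w_i] and [w_{i+1}]
   on the ends of an edge; [b, c, c'] are those of the image of [v_{i i+1}] on the
   edge and its ends. *)
Lemma edge_solve (x x' y y' c c' b mu : k) : mu != 0 ->
  x - y = mu -> x' - y' = - mu ->
  c * mu - x * x + y * y = - (b * mu) -> c' * mu - x' * x + y' * y = 0 ->
  c' * - mu - x' * x' + y' * y' = b * mu ->
  [/\ x + x' = b, y + y' = b, c = x + y - b & c' = x' + y' - b].
Proof.
move=> mu0 /eqP; rewrite subr_eq => /eqP -> /eqP; rewrite subr_eq => /eqP -> e1 e2 e3.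
(* The difference of the squares of [x] and [y] is [mu * (x + y)], so cancelling [mu] leaves
   [c = x + y - b]; the other end is treated in the same way. *)
have cE : c = mu + y + y - b.
  apply: (mulIf mu0); rewrite -[LHS](subrK (- ((mu + y) * (mu + y)) + y * y)).
  rewrite opprD !addrA.
  have -> : c * mu = - (b * mu) + (mu + y) * (mu + y) - y * y by rewrite -e1; ring.
  by ring.
have c'E : c' = - mu + y' + y' - b.
  apply: (mulIf mu0).
  have -> : c' * mu = - (b * mu) - (- mu + y') * (- mu + y') + y' * y'.
    by rewrite -e3; ring.
  by ring.
(* After substitution the mixed equation [e2] collapses to [mu * (y + y' - b) = 0]. *)
have yE : y + y' = b.
  apply: (mulIf mu0); apply/eqP; rewrite -subr_eq0 -e2 c'E; apply/eqP; ring.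
by split=> //; rewrite -yE; ring.
Qed.

Variable n : nat.
Hypothesis n3 : (2 < n)%N.
Implicit Types (a c x y la : 'I_n -> k).

(** In the [v w] equations the left side has rank one, while row [j] of the right side is a multiple
    of the difference of the ends of the edge [j]. As distinct edges have distinct pairs of ends,
    [a] lives on one edge [s], and [b] is [a s]. The [w w] equations then confine everything else to
    that edge and reduce to [edge_solve]. *)
Lemma edge_form1 a c x y la :
  (exists j, a j != 0) -> (exists l, x l != y l) ->
  (forall j l, a j * (x l - y l) = la j * ((l == j)%:R - (l == ordS j)%:R)) ->
  (forall p q, c p * (x q - y q) - x p * x q + y p * y q =
     (p == q)%:R * (la (ord_pred p) - la p)) ->
  exists s b, [/\ b != 0, forall j, a j = b * (j == s)%:R,
    forall l, (x l != y l) = (l \in [set s; ordS s]),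
    forall q, q \notin [set s; ordS s] -> [/\ x q = 0, y q = 0 & c q = 0]
    & [/\ x s + x (ordS s) = b, y s + y (ordS s) = b,
          c s = x s + y s - b & c (ordS s) = x (ordS s) + y (ordS s) - b]].
Proof.
move=> [s as0] [l0 xyl0] h1 h2.
have n2 := ltnW n3.
have sS : (s == ordS s) = false by rewrite eq_sym (negPf (ordS_neq s n2)).
have Ss : (ordS s == s) = false by rewrite eq_sym.
have diffE l : x l - y l = la s / a s * ((l == s)%:R - (l == ordS s)%:R).
  by apply: (mulfI as0); rewrite h1; field.
set mu := la s / a s in diffE.
have mu0 : mu != 0.
  apply: contra_neq xyl0 => mu0; apply/eqP.
  by rewrite -subr_eq0 diffE mu0 mul0r.
have suppE l : (x l != y l) = (l \in [set s; ordS s]).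
  rewrite -subr_eq0 diffE mulf_eq0 (negPf mu0) /= !inE.
  have [->|_] := eqVneq l s; first by rewrite sS subr0 oner_eq0.
  by rewrite sub0r oppr_eq0; case: (l == _); rewrite ?oner_eq0 ?eqxx.
have aE j : a j = a s * (j == s)%:R.
  have [->|js] := eqVneq j s; first by rewrite mulr1.
  rewrite mulr0; apply/eqP/contraT => aj0.
  (* If [a j] were nonzero too, both ends of the edge [s] would be ends of the edge [j], making [j]
     its own second successor; this is excluded by [n >= 3]. *)
  have supp' l : l \in [set s; ordS s] -> l \in [set j; ordS j].
    rewrite -suppE -subr_eq0 => ne; have := h1 j l; rewrite !inE.
    case: eqP => //= _; case: eqP => //= _; rewrite subrr mulr0 => /eqP.
    by rewrite mulf_eq0 (negPf aj0) (negPf ne).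
  have := supp' s; rewrite !inE eqxx [s == j]eq_sym (negPf js) => /(_ isT) /= /eqP sE.
  have := supp' (ordS s); rewrite !inE eqxx orbT => /(_ isT).
  by rewrite (inj_eq (@ordS_inj n)) [s == j]eq_sym (negPf js) sE (negPf (ordSS_neq j n3)).
exists s, (a s).
have laE : la s = a s * mu by rewrite /mu; field.
have la0 j : j != s -> la j = 0.
  move=> js; have := h1 j j.
  by rewrite aE (negPf js) !mulr0 mul0r eqxx eq_sym (negPf (ordS_neq j n2)) subr0 mulr1.
have laS : la (ord_pred s) = 0.
  by apply: la0; rewrite -(inj_eq (@ordS_inj n)) ord_predK sS.
have xs : x s - y s = mu by rewrite diffE eqxx sS subr0 mulr1.
have xS : x (ordS s) - y (ordS s) = - mu by rewrite diffE eqxx Ss sub0r mulrN1.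
(* Off the edge [x] and [y] agree, so the word [w_s w_q] leaves only [mu] times [x q], up to sign;
   then [w_q w_s] leaves [mu] times [c q]. *)
have out q : q \notin [set s; ordS s] -> [/\ x q = 0, y q = 0 & c q = 0].
  move=> qs; have xyq : x q = y q by apply/eqP; rewrite -[_ == _]negbK suppE.
  move: qs; rewrite !inE negb_or => /andP[qs qS].
  have xq0 : x q = 0.
    apply: (mulfI mu0); rewrite mulr0 -xs; have := h2 s q.
    rewrite eq_sym (negPf qs) mul0r -xyq subrr mulr0 sub0r => e.
    by rewrite -[RHS]oppr0 -e; ring.
  split=> //; first by rewrite -xyq.
  apply: (mulIf mu0); rewrite mul0r; have := h2 q s.
  by rewrite (negPf qs) mul0r -xyq xq0 !mul0r subr0 addr0 xs.
split=> //.
apply: (edge_solve mu0 xs xS).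
- by have := h2 s s; rewrite eqxx xs laS laE sub0r mul1r.
- by have := h2 (ordS s) s; rewrite Ss xs mul0r.
- have := h2 (ordS s) (ordS s).
  by rewrite eqxx xS ordSK laE (la0 (ordS s)) ?Ss // subr0 mul1r.
Qed.

End Edges.

(** * Dihedral permutations from maps preserving edges *)

Section Vertices.
Variable n : nat.
Implicit Types i j : 'I_n.

Lemma ordS_iter i j : exists m, j = iter m (@ordS n) i.
Proof.
exists (n - i + j)%N; apply/ord_inj; rewrite val_iter_ordS addnA.
by rewrite subnKC ?(ltnW (ltn_ord i)) // modnDl modn_small.
Qed.

(** A map commuting with the successor is a rotation, determined by its value at one index; the
    agreement then spreads around the cycle. *)
Lemma ordS_commE (t : 'I_n -> 'I_n) : (forall i, t (ordS i) = ordS (t i)) ->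
  exists m, forall i, t i = iter m (@ordS n) i.
Proof.
move=> tS; have [n0|n0] := posnP n.
  by exists 0%N => -[i lt]; exfalso; rewrite n0 in lt.
pose i0 := Ordinal n0; have [m t0] := ordS_iter i0 (t i0).
exists m => i; apply/eqP.
rewrite (ordS_const (f := fun i => t i == iter m (@ordS n) i) _ i i0) ?t0 //.
by move=> j /=; rewrite tS -iterSr iterS (inj_eq (@ordS_inj n)).
Qed.

Lemma rotXV m i : (Defs.rot n ^+ m)%g (gV i) = gV (iter m (@ordS n) i).
Proof. by elim: m => [|m IH]; rewrite ?perm1 // expgSr permM IH permE. Qed.

Lemma rotXU m : (Defs.rot n ^+ m)%g gU = gU.
Proof. by elim: m => [|m IH]; rewrite ?perm1 // expgSr permM IH permE. Qed.

(* [t] sends the edge from [i] to its successor to the edge starting at [s i]. *)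
Lemma dihedral_of_edges (t s : 'I_n -> 'I_n) : (2 < n)%N -> injective t ->
  (forall i, (s i = t i /\ t (ordS i) = ordS (t i)) \/
             (s i = t (ordS i) /\ t i = ordS (t (ordS i)))) ->
  exists2 g : {perm gen n}, g \in dihedral n &
    [/\ g gU = gU, forall i, g (gV i) = gV (s i) & forall i, g (gW i) = gW (t i)].
Proof.
move=> n3 t_inj edge.
have rD m : (Defs.rot n ^+ m)%g \in dihedral n by rewrite groupX // mem_gen ?set21.
have fD : Defs.refl n \in dihedral n by rewrite mem_gen ?set22.
have notSS i j : t i = t j -> i = ordS (ordS j) -> False.
  by move=> /t_inj -> /eqP; rewrite eq_sym (negPf (ordSS_neq _ n3)).
(* [f i] says that [t] keeps the orientation of the edge [i]. *)
pose f i := t (ordS i) == ordS (t i).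
have edgeT i : f i -> s i = t i.
  move/eqP => ft; case: (edge i) => [[]//|[_ e]]; exfalso.
  by have := ordSS_neq (t i) n3; rewrite -ft -e eqxx.
have edgeF i : ~~ f i -> s i = t (ordS i) /\ t i = ordS (t (ordS i)).
  by rewrite /f; case: (edge i) => [[_ ->]|]; rewrite ?eqxx.
(* A change of orientation between adjacent edges would fold the cycle, sending [i] and its second
   successor to the same vertex. *)
have fS i : f (ordS i) = f i.
  have ne : t (ordS (ordS i)) <> t i.
    by move/t_inj/eqP; rewrite (negPf (ordSS_neq i n3)).
  case fi: (f i); case fSi: (f (ordS i)) => //; case: ne.
    have [_ e] := edgeF _ (negbT fSi); apply: (@ordS_inj n).
    by rewrite -e (eqP fi).
  by have [_ ->] := edgeF _ (negbT fi); rewrite (eqP fSi).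
have fE := ordS_const fS.
have [/existsP[i0 f0]|] := boolP [exists i, f i].
  have fT i : f i by rewrite (fE i i0).
  have [m tm] := ordS_commE (fun i => eqP (fT i)).
  exists (Defs.rot n ^+ m)%g => //; split=> [|i|i].
  - exact: rotXU.
  - by rewrite rotXV edgeT // tm.
  - by rewrite rotX tm.
rewrite negb_exists => /forallP fF.
have tE i := (edgeF i (fF i)).2; have sE i := (edgeF i (fF i)).1.
(* When [t] reverses all edges, precomposing it with the reflection of the indices gives a map that
   commutes with the successor. *)
have [|m tm] := @ordS_commE (t \o @rev_ord n).
  by move=> i /=; rewrite tE ordS_rev.
have {}tm i : t i = iter m (@ordS n) (rev_ord i) by rewrite -tm /= rev_ordK.
exists (Defs.refl n * Defs.rot n ^+ m)%g; first by rewrite groupM.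
split=> [|i|i]; rewrite permM permE /=.
- exact: rotXU.
- by rewrite rotXV sE tm.
- by rewrite rotX tm.
Qed.

Lemma big_gen (V : nmodType) (F : gen n -> V) :
  \sum_x F x = F gU + \sum_i F (gV i) + \sum_i F (gW i).
Proof.
pose I := index_enum 'I_n.
rewrite (perm_big (gU :: [seq gV i | i <- I] ++ [seq gW i | i <- I])).
  by rewrite big_cons big_cat !big_map /= addrA.
apply: uniq_perm; rewrite ?index_enum_uniq //=.
  rewrite cat_uniq !map_inj_uniq ?index_enum_uniq ?mem_cat; try exact: gV_inj;
    try exact: gW_inj.
  rewrite andbT; apply/andP; split.
    by rewrite negb_or; apply/andP; split; apply/mapP => -[].
  by apply/hasPn => _ /mapP[i _ ->]; apply/mapP => -[].
move=> x; rewrite mem_index_enum inE mem_cat; case: x => [|i|i] //.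
  by rewrite map_f ?mem_index_enum // !orbT.
by rewrite [X in _ || (_ || X)]map_f ?mem_index_enum // !orbT.
Qed.

Lemma sum_edge (V : nmodType) (F : 'I_n -> V) i : (1 < n)%N ->
  (forall j, j \notin [set i; ordS i] -> F j = 0) -> \sum_j F j = F i + F (ordS i).
Proof.
move=> n2 F0; rewrite (bigD1 i) // (bigD1 (ordS i)) ?ordS_neq //= big1 ?addr0 // => j.
by move=> /andP[ji jS]; apply: F0; rewrite !inE negb_or ji.
Qed.

End Vertices.

(** * Every automorphism of the polygon algebra is a multiple of a dihedral permutation *)

Section PolygonAutomorphisms.
Variables (n : nat) (k : fieldType).
Hypothesis n3 : (2 < n)%N.
Local Notation PP := (polygon_presentation n k).
Local Notation A := (presented_alg PP).
Local Notation L := (@alin k (gen n) (@gen_level n) (polygon_relators n k)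
  (@polygon_relators_const n k)).

Section Coefficients.
Variables (phi : AutGF PP) (m m' : gen n -> gen n -> k).
Hypothesis mE : forall x, phi (polygon_gen x) = L (m x).
Hypothesis m_lev : forall x y, m x y != 0 -> (gen_level y <= gen_level x)%N.
Hypothesis m'_lev : forall x y, m' x y != 0 -> (gen_level y <= gen_level x)%N.
Hypothesis mm' : forall x z, \sum_y m x y * m' y z = (x == z)%:R.

Let m0 x y : (gen_level x < gen_level y)%N -> m x y = 0.
Proof. by rewrite ltnNge => lt; apply/eqP; apply: contraNT lt => /m_lev. Qed.
Let m'0 x y : (gen_level x < gen_level y)%N -> m' x y = 0.
Proof. by rewrite ltnNge => lt; apply/eqP; apply: contraNT lt => /m'_lev. Qed.

(** By triangularity of [m] and [m'], only the terms within the level survive, so the diagonal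
    blocks of the two matrices are mutually inverse. *)
Let mVV i i' : \sum_j m (gV i) (gV j) * m' (gV j) (gV i') = (i == i')%:R.
Proof.
rewrite -[RHS]/((gV i == gV i')%:R) -mm' big_gen m0 // mul0r add0r [X in _ = _ + X]big1.
  by rewrite addr0.
by move=> j _; rewrite m'0 ?mulr0.
Qed.

Let mWW i i' : \sum_j m (gW i) (gW j) * m' (gW j) (gW i') = (i == i')%:R.
Proof.
rewrite -[RHS]/((gW i == gW i')%:R) -mm' big_gen m0 // mul0r add0r [X in _ = X + _]big1.
  by rewrite add0r.
by move=> j _; rewrite m0 ?mul0r.
Qed.

Let form1 i : L (m (gV i)) * (L (m (gW i)) - L (m (gW (ordS i)))) -
  L (m (gW i)) ^+ 2 + L (m (gW (ordS i))) ^+ 2 = 0.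
Proof.
rewrite -!mE; pose pi := @alg_pi k PP.
apply: etrans (esym (rmorph_form1 phi _ _ _)) _.
apply: etrans (congr1 phi (esym (rmorph_form1 pi _ _ _))) _.
apply: etrans (congr1 phi (alg_pi_relator _)) (raddf0 _).
by rewrite mem_cat; apply/orP; left; apply: (map_f (@polygon_rel1 n k)); rewrite mem_enum.
Qed.

Let form2 i : L (m gU) * (L (m (gV i)) - L (m (gV (ordS i)))) -
  L (m (gV i)) ^+ 2 + L (m (gV (ordS i))) ^+ 2 +
  (L (m (gV i)) - L (m (gV (ordS i)))) * L (m (gW (ordS i))) = 0.
Proof.
rewrite -!mE; pose pi := @alg_pi k PP.
apply: etrans (esym (rmorph_form2 phi _ _ _ _)) _.
apply: etrans (congr1 phi (esym (rmorph_form2 pi _ _ _ _))) _.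
apply: etrans (congr1 phi (alg_pi_relator _)) (raddf0 _).
by rewrite mem_cat; apply/orP; right; apply: (map_f (@polygon_rel2 n k)); rewrite mem_enum.
Qed.

Let a (i l : 'I_n) : k := m (gW i) (gW l).

Let edges : exists s : 'I_n -> 'I_n, exists b : 'I_n -> k, forall i,
  [/\ b i != 0, forall j, m (gV i) (gV j) = b i * (j == s i)%:R,
      forall l, (a i l != a (ordS i) l) = (l \in [set s i; ordS (s i)]),
      forall q, q \notin [set s i; ordS (s i)] ->
        [/\ a i q = 0, a (ordS i) q = 0 & m (gV i) (gW q) = 0]
    & [/\ a i (s i) + a i (ordS (s i)) = b i,
          a (ordS i) (s i) + a (ordS i) (ordS (s i)) = b i,
          m (gV i) (gW (s i)) = a i (s i) + a (ordS i) (s i) - b i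
        & m (gV i) (gW (ordS (s i))) =
            a i (ordS (s i)) + a (ordS i) (ordS (s i)) - b i]].
Proof.
suff ex i : exists sb : 'I_n * k,
  [/\ sb.2 != 0, forall j, m (gV i) (gV j) = sb.2 * (j == sb.1)%:R,
      forall l, (a i l != a (ordS i) l) = (l \in [set sb.1; ordS sb.1]),
      forall q, q \notin [set sb.1; ordS sb.1] ->
        [/\ a i q = 0, a (ordS i) q = 0 & m (gV i) (gW q) = 0]
    & [/\ a i sb.1 + a i (ordS sb.1) = sb.2,
          a (ordS i) sb.1 + a (ordS i) (ordS sb.1) = sb.2,
          m (gV i) (gW sb.1) = a i sb.1 + a (ordS i) sb.1 - sb.2
        & m (gV i) (gW (ordS sb.1)) =
            a i (ordS sb.1) + a (ordS i) (ordS sb.1) - sb.2]].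
  by have [f fP] := choice ex; exists (fun i => (f i).1), (fun i => (f i).2).
have [|||||la [h1 h2]] := polygon_form1_coefs _ _ _ _ _ (form1 i);
  try by move=> *; apply: m0.
(* Invertibility of the diagonal blocks rules out a zero row among the [v], and equal rows for
   adjacent [w]. *)
have neV : exists j, m (gV i) (gV j) != 0.
  apply/existsP; apply: contraT; rewrite negb_exists => /forallP m00.
  have := mVV i i; rewrite eqxx big1 => [/esym/eqP|j _]; first by rewrite oner_eq0.
  by have := m00 j; rewrite negbK => /eqP ->; rewrite mul0r.
have neW : exists l, a i l != a (ordS i) l.
  apply/existsP; apply: contraT; rewrite negb_exists => /forallP aa.
  have := mWW i i; rewrite eqxx => /eqP.
  rewrite (eq_bigr (fun j => m (gW (ordS i)) (gW j) * m' (gW j) (gW i))) => [|j _].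
    by rewrite mWW (negPf (ordS_neq i (ltnW n3))) eq_sym oner_eq0.
  by have := aa j; rewrite negbK /a => /eqP ->.
have [s [b sb]] := edge_form1 n3 neV neW h1 h2.
by exists (s, b).
Qed.

Lemma polygon_aut_coefs : exists (b : k) (t s : 'I_n -> 'I_n),
  [/\ b != 0, injective t, forall i j, m (gV i) (gV j) = b * (j == s i)%:R,
      forall i j, m (gW i) (gW j) = b * (j == t i)%:R
    & (forall i j, m (gV i) (gW j) = 0) /\
      forall i, (s i = t i /\ t (ordS i) = ordS (t i)) \/
             (s i = t (ordS i) /\ t i = ordS (t (ordS i)))].
Proof.
have [s [b sbP]] := edges.
have n2 := ltnW n3.
have b0 i : b i != 0 by case: (sbP i).
have sumr i : \sum_l a i l = b i.
  have [_ _ _ out [e _ _ _]] := sbP i.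
  by rewrite -e; apply: sum_edge => // j /out[].
have sumS i : \sum_l a (ordS i) l = b i.
  have [_ _ _ out [_ e _ _]] := sbP i.
  by rewrite -e; apply: sum_edge => // j /out[].
(* The row of [w_{i+1}] belongs to the edges [i] and [i+1], so its sum equals both [b i] and
   [b (i+1)]; hence [b] is constant. *)
have bE := @ordS_const n k b (fun i => etrans (esym (sumr (ordS i))) (sumS i)).
(* Otherwise two rows of the invertible [v] block would be proportional. *)
have s_inj i i' : s i = s i' -> i = i'.
  move=> e; apply/eqP/contraT => ne.
  have m1 j : \sum_l m (gV j) (gV l) * m' (gV l) (gV i') = b j * m' (gV (s j)) (gV i').
    have [_ mV _ _ _] := sbP j.
    under eq_bigr => l _ do rewrite mV eq_sym mulrAC.
    by rewrite (sum_delta (fun l => b j * m' (gV l) (gV i'))).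
  have := m1 i'; rewrite mVV eqxx -e => /eqP.
  have /esym/eqP := m1 i; rewrite mVV (negPf ne) mulf_eq0 (negPf (b0 i)) /= => /eqP ->.
  by rewrite mulr0 oner_eq0.
have row i : exists t, forall l, a i l = b i * (l == t)%:R.
  (* The row of [w_i] is supported on both edges [p] and [q]. These are distinct, so for [n >= 3]
     they share at most one vertex: it is [p] if [p] follows [q], and otherwise it can only be [q].
     The row sum gives the value there. *)
  pose p := s (ord_pred i); pose q := s i.
  have [_ _ _ outp _] := sbP (ord_pred i); rewrite -/p ord_predK in outp.
  have [_ _ _ outq _] := sbP i; rewrite -/q in outq.
  have pq : p != q.
    apply/eqP => /s_inj /(congr1 (@ordS n)); rewrite ord_predK => /esym/eqP.
    by rewrite (negPf (ordS_neq i n2)).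
  pose t := if p == ordS q then p else q.
  have supp l : l != t -> a i l = 0.
    have [lp|/outp[_ -> _]//] := boolP (l \in [set p; ordS p]).
    have [lq|/outq[-> _ _]//] := boolP (l \in [set q; ordS q]).
    move=> lt; exfalso; move: lp lq lt; rewrite !inE /t.
    have [pE|pE] := eqVneq p (ordS q).
      rewrite -pE => /orP[->//|/eqP lS] /orP[/eqP lq|->//] _.
      by have := ordSS_neq q n3; rewrite -pE -lS lq eqxx.
    move=> lp /orP[->//|/eqP lq] _; move: lp; rewrite lq eq_sym (negPf pE) /=.
    by rewrite (inj_eq (@ordS_inj n)) eq_sym (negPf pq).
  exists t => l; have [->|/supp //] := eqVneq l t; last by rewrite mulr0.
  by rewrite mulr1 -(sumr i) (bigD1 t) //= big1 ?addr0.
have [t tP] := choice row.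
have ta i l : a i l = b i * (l == t i)%:R by apply: tP.
have t_inj i i' : t i = t i' -> i = i'.
  move=> e; apply/eqP/contraT => ne.
  have := mWW i i'; rewrite (negPf ne) (eq_bigr (fun j => m (gW i') (gW j) * m' (gW j) (gW i'))).
    by rewrite mWW eqxx => /eqP; rewrite oner_eq0.
  by move=> j _; rewrite -![m (gW _) _]/(a _ j) !ta e (bE i i').
(* The rows of [w_i] and [w_{i+1}] differ at [t i] and at [t (ordS i)], so these two vertices are
   the ends of the edge [s i], in one order or the other. *)
have ends i : (s i = t i /\ t (ordS i) = ordS (t i)) \/
             (s i = t (ordS i) /\ t i = ordS (t (ordS i))).
  have [_ _ supp _ _] := sbP i.
  have tne : (t i == t (ordS i)) = false.
    apply/eqP => /t_inj/esym/eqP; by rewrite (negPf (ordS_neq i n2)).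
  have : t i \in [set s i; ordS (s i)].
    by rewrite -supp !ta eqxx tne mulr1 mulr0 b0.
  have : t (ordS i) \in [set s i; ordS (s i)].
    by rewrite -supp !ta eqxx [t (ordS i) == t i]eq_sym tne mulr1 mulr0 eq_sym b0.
  rewrite !inE => /orP[] /eqP e /orP[] /eqP e'; move: tne; rewrite ?e ?e' ?eqxx //.
    by right.
  by left.
exists (b (Ordinal (ltnW n2))), t, s; split=> //.
- by move=> i j; have [_ -> _ _ _] := sbP i; rewrite (bE i (Ordinal (ltnW n2))).
- by move=> i j; rewrite -[LHS]/(a i j) ta (bE i (Ordinal (ltnW n2))).
(* At each end of the edge [s i] exactly one of the two rows has the entry [b], so the formula of
   the edge gives [b - b]. *)
split=> // i j; have [_ _ _ out [_ _ e1 e2]] := sbP i.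
have [|/out[]//] := boolP (j \in [set s i; ordS (s i)]).
have S1 := negPf (ordS_neq (s i) n2).
rewrite !inE => /orP[] /eqP ->; rewrite ?e1 ?e2 !ta (bE (ordS i) i).
  case: (ends i) => -[e e']; rewrite ?e' -e eqxx ?[_ == ordS _]eq_sym S1.
    by rewrite mulr1 mulr0 addr0 subrr.
  by rewrite mulr1 mulr0 add0r subrr.
case: (ends i) => -[e e']; rewrite ?e' -e eqxx S1.
  by rewrite mulr1 mulr0 add0r subrr.
by rewrite mulr1 mulr0 addr0 subrr.
Qed.

(** Relation 2) at a single index suffices: [v_i - v_{i+1}] goes to [b] times a difference of two
    distinct edges plus nothing in the [w]. The words [w v] remove the [w] part of the image of [u],
    and the words [v v], combined with [u v], remove its [v] part and give the coefficient [b] on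
    [u]. *)
Lemma polygon_aut_coefs_U (b : k) (s : 'I_n -> 'I_n) : b != 0 ->
  (forall i j, m (gV i) (gV j) = b * (j == s i)%:R) ->
  (forall i j, m (gV i) (gW j) = 0) ->
  [/\ m gU gU = b, forall j, m gU (gV j) = 0 & forall j, m gU (gW j) = 0].
Proof.
move=> b0 mV mW; pose i : 'I_n := Ordinal (ltnW (ltnW n3)).
have [|||||mu [h1 h2 h3]] := polygon_form2_coefs _ _ _ _ _ (form2 i);
  try by move=> *; rewrite ?mW // m0.
have sS : s (ordS i) != s i.
  apply: contraTneq (ordS_neq i (ltnW n3)) => e; rewrite negbK; apply/eqP.
  have := mVV (ordS i) i; rewrite (eq_bigr (fun j => m (gV i) (gV j) * m' (gV j) (gV i))).
    rewrite mVV eqxx; case: eqP => // _ /eqP; by rewrite oner_eq0.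
  by move=> j _; rewrite !mV e.
have cW p : m gU (gW p) = 0.
  have := h3 p (s i); rewrite !mV eqxx eq_sym (negPf sS) mulr0 subr0 mulr1 => /eqP.
  by rewrite mulf_eq0 (negPf b0) orbF => /eqP.
have h4 p : m gU (gV p) * b - b * (p == s i)%:R * b = - ((p == s i)%:R * (m gU gU * b)).
  have := h2 p (s i); have := h1 (s i).
  rewrite !mV eqxx [s i == s (ordS i)]eq_sym (negPf sS) !mulr0 !subr0 !mulr1 addr0 => ->.
  move=> ->; have [->|] := eqVneq p (s i); last by rewrite !mul0r oppr0.
  by rewrite !mul1r opprB.
have cS : m gU (gV (s i)) = 0.
  have := h2 (s i) (s (ordS i)).
  rewrite !mV !eqxx [s i == s (ordS i)]eq_sym (negPf sS).
  rewrite !(mulr0, mul0r, mulr1, sub0r, subr0, addr0) mulrN => /eqP.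
  by rewrite oppr_eq0 mulf_eq0 (negPf b0) orbF => /eqP.
split=> //.
  have := h4 (s i); rewrite cS mul0r eqxx mulr1 mul1r sub0r => /oppr_inj.
  by move/(mulIf b0).
move=> j; have [->//|ne] := eqVneq j (s i).
have := h4 j; rewrite (negPf ne) !(mulr0, mul0r) subr0 oppr0 => /eqP.
by rewrite mulf_eq0 (negPf b0) orbF => /eqP.
Qed.

End Coefficients.

Lemma polygon_aut_form (phi : AutGF PP) : exists2 b : k, b != 0 &
  exists2 g : {perm gen n}, g \in dihedral n &
  forall x, phi (polygon_gen x) = b *: polygon_gen (g x).
Proof.
have [m [m' [mE m_lev m'_lev mm']]] := aut_alin_inv (@polygon_rels1 n k) phi.
have [b [t [s [b0 t_inj mV mW [mVW edge]]]]] := polygon_aut_coefs mE m_lev m'_lev mm'.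
have [mUU mUV mUW] := polygon_aut_coefs_U mE m_lev m'_lev mm' b0 mV mVW.
have [g gD [gU_ gV_ gW_]] := dihedral_of_edges n3 t_inj edge.
have m0 x y : (gen_level x < gen_level y)%N -> m x y = 0.
  by rewrite ltnNge => lt; apply/eqP; apply: contraNT lt => /m_lev.
exists b => //; exists g => // x.
suff mx y : m x y = b * (g x == y)%:R.
  rewrite (_ : polygon_gen (g x) = L (fun y => (g x == y)%:R)); last exact: alin_delta.
  rewrite /polygon_gen mE /alin scaler_sumr; apply: eq_bigr => y _.
  by rewrite scalerA mx.
case: x => [|i|i]; rewrite ?gU_ ?gV_ ?gW_; case: y => [|j|j]; rewrite ?gen_eqE ?eqxx.
- by rewrite mulr1.
- by rewrite mulr0.
- by rewrite mulr0.
- by rewrite mulr0 m0.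
- by rewrite mV eq_sym.
- by rewrite mulr0 mVW.
- by rewrite mulr0 m0.
- by rewrite mulr0 m0.
- by rewrite mW eq_sym.
Qed.

End PolygonAutomorphisms.

(** * Construction of the automorphisms of the polygon algebra *)

Section FormIdentities.
Variables (k : fieldType) (B : algType k).
Implicit Types a b c d : B.

(** Serves the reflection, which reverses edges: exchanging the ends only changes the sign of the
    relator. *)
Lemma form1_swap a b c :
  a * (c - b) - c ^+ 2 + b ^+ 2 = - (a * (b - c) - b ^+ 2 + c ^+ 2).
Proof. by rewrite -[c - b]opprB mulrN opprD opprB addrC addrA. Qed.

Lemma form2_swap a b c d :
  a * (c - b) - c ^+ 2 + b ^+ 2 + (c - b) * d =
  - (a * (b - c) - b ^+ 2 + c ^+ 2 + (b - c) * d).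
Proof. by rewrite form1_swap -[c - b]opprB mulNr -opprD. Qed.

Lemma form1_scale (z : k) a b c :
  (z *: a) * (z *: b - z *: c) - (z *: b) ^+ 2 + (z *: c) ^+ 2 =
  z ^+ 2 *: (a * (b - c) - b ^+ 2 + c ^+ 2).
Proof.
by rewrite -scalerBr -scalerAl -scalerAr scalerA -expr2 !exprZn scalerDr scalerBr.
Qed.

Lemma form2_scale (z : k) a b c d :
  (z *: a) * (z *: b - z *: c) - (z *: b) ^+ 2 + (z *: c) ^+ 2 +
    (z *: b - z *: c) * (z *: d) =
  z ^+ 2 *: (a * (b - c) - b ^+ 2 + c ^+ 2 + (b - c) * d).
Proof.
by rewrite form1_scale -scalerBr -scalerAl -scalerAr scalerA -expr2 -scalerDr.
Qed.

End FormIdentities.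

Section PolygonAutGroup.
Variables (n : nat) (k : fieldType).
Local Notation PP := (polygon_presentation n k).
Local Notation A := (presented_alg PP).
Local Notation pgen := (@polygon_gen n k).

Lemma polygon_form1_gen i : pgen (gV i) * (pgen (gW i) - pgen (gW (ordS i))) -
  pgen (gW i) ^+ 2 + pgen (gW (ordS i)) ^+ 2 = 0.
Proof.
apply: etrans (esym (rmorph_form1 (@alg_pi k PP) _ _ _)) _; apply: alg_pi_relator.
by rewrite mem_cat; apply/orP; left; apply: (map_f (@polygon_rel1 n k)); rewrite mem_enum.
Qed.

Lemma polygon_form2_gen i : pgen gU * (pgen (gV i) - pgen (gV (ordS i))) -
  pgen (gV i) ^+ 2 + pgen (gV (ordS i)) ^+ 2 +
  (pgen (gV i) - pgen (gV (ordS i))) * pgen (gW (ordS i)) = 0.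
Proof.
apply: etrans (esym (rmorph_form2 (@alg_pi k PP) _ _ _ _)) _; apply: alg_pi_relator.
by rewrite mem_cat; apply/orP; right; apply: (map_f (@polygon_rel2 n k)); rewrite mem_enum.
Qed.

Lemma polygon_hom (B : algType k) (g : gen n -> B) :
  (forall i, g (gV i) * (g (gW i) - g (gW (ordS i))) -
     g (gW i) ^+ 2 + g (gW (ordS i)) ^+ 2 = 0) ->
  (forall i, g gU * (g (gV i) - g (gV (ordS i))) -
     g (gV i) ^+ 2 + g (gV (ordS i)) ^+ 2 +
     (g (gV i) - g (gV (ordS i))) * g (gW (ordS i)) = 0) ->
  exists h : {lrmorphism A -> B}, forall x, h (pgen x) = g x.
Proof.
move=> g1 g2; apply: (@presented_hom k PP) => r; rewrite mem_cat => /orP[] /mapP[i _ ->].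
  by apply: etrans (rmorph_form1 (free_hom g) _ _ _) _; rewrite /= !free_hom_gen.
by apply: etrans (rmorph_form2 (free_hom g) _ _ _ _) _; rewrite /= !free_hom_gen.
Qed.

Lemma polygon_scale_hom (z : k) :
  exists h : {lrmorphism A -> A}, forall x, h (pgen x) = z *: pgen x.
Proof.
apply: polygon_hom => i.
  by apply: etrans (form1_scale _ _ _ _) _; rewrite polygon_form1_gen scaler0.
by apply: etrans (form2_scale _ _ _ _ _) _; rewrite polygon_form2_gen scaler0.
Qed.

Lemma polygon_dihedral_hom (s : {perm gen n}) : s \in dihedral n ->
  (forall x, gen_level (s x) = gen_level x) /\
  exists h : {lrmorphism A -> A}, forall x, h (pgen x) = pgen (s x).
Proof.
pose Q (s : {perm gen n}) := (forall x, gen_level (s x) = gen_level x) /\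
  exists h : {lrmorphism A -> A}, forall x, h (pgen x) = pgen (s x).
have Q1 : Q 1%g.
  by split=> [x|]; [rewrite perm1|exists idfun => x; rewrite perm1].
have QM s1 s2 : Q s1 -> Q s2 -> Q (s1 * s2)%g.
  move=> [l1 [h1 h1E]] [l2 [h2 h2E]]; split=> [x|]; first by rewrite permM l2 l1.
  by exists (h2 \o h1) => x; rewrite permM -h2E -h1E.
have Qrot : Q (Defs.rot n).
  split=> [[|i|i]|]; rewrite ?permE //.
  by apply: polygon_hom => i; rewrite !permE /=;
    [exact: polygon_form1_gen|exact: polygon_form2_gen].
have Qrefl : Q (Defs.refl n).
  split=> [[|i|i]|]; rewrite ?permE //.
  apply: polygon_hom => i; rewrite !permE /=.
    (* With [j = rev_ord (ordS i)] the image of the relator is the one at [j] with its ends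
       exchanged; for relation 2) the index is [rev_ord (ordS (ordS i))]. *)
    rewrite -(ordS_rev i); apply: etrans (form1_swap _ _ _) _.
    exact: etrans (congr1 -%R (polygon_form1_gen _)) (oppr0 _).
  rewrite -(ordS_rev (ordS i)); apply: etrans (form2_swap _ _ _ _) _.
  exact: etrans (congr1 -%R (polygon_form2_gen _)) (oppr0 _).
case/gen_prodgP => m [c cP ->]; apply: (big_ind Q) => // i _.
by have := cP i; rewrite !inE => /orP[] /eqP ->.
Qed.

Lemma polygon_aut_exists (z : units k) (s : {perm gen n}) : s \in dihedral n ->
  exists phi : AutGF PP, forall x, phi (pgen x) = val z *: pgen (s x).
Proof.
move=> sD; have [sl [hs hsE]] := polygon_dihedral_hom sD.
have [sl' [hs' hs'E]] := polygon_dihedral_hom (groupVr sD).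
have [hz hzE] := polygon_scale_hom (val z).
have [hz' hz'E] := polygon_scale_hom (val z)^-1.
have z0 := uvalP z.
have lrZ (f : {lrmorphism A -> A}) c a : f (c *: a) = c *: f a by exact: linearZZ.
pose h : {lrmorphism A -> A} := hs \o hz; pose h' : {lrmorphism A -> A} := hs' \o hz'.
have hE x : h (pgen x) = val z *: pgen (s x) by rewrite /= hzE linearZ /= hsE.
have h'E x : h' (pgen x) = (val z)^-1 *: pgen (s^-1%g x).
  by rewrite /= hz'E linearZ /= hs'E.
have lin (g : gen n -> gen n) c x : (forall x, gen_level (g x) = gen_level x) ->
    @lin_part k PP (gen_level x) (c *: pgen (g x)).
  by move=> gl; apply/word_spanZ/lin_part_gen; rewrite /= gl.
have hP : gf_aut (@graded_part k PP) (@filtered_part k PP) h.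
  apply: (gf_aut_lin (h' := h')) => x.
  - by rewrite -[agen x]/(pgen x) h'E lrZ hE scalerA mulVr // scale1r permKV.
  - by rewrite -[agen x]/(pgen x) hE lrZ h'E scalerA mulrV // scale1r permK.
  - by rewrite -[agen x]/(pgen x) hE; apply: lin.
  - by rewrite -[agen x]/(pgen x) h'E; apply: lin.
by exists (MkAut (asboolT hP)) => x; apply: hE.
Qed.

(** Linear independence of the generators; this makes the parametrization of the group injective. *)
Lemma scale_pgen_inj (a b : k) (x y : gen n) : a != 0 ->
  a *: pgen x = b *: pgen y -> x = y /\ a = b.
Proof.
move=> a0; pose d c (x y : gen n) : k := c * (x == y)%:R.
have E c z : c *: pgen z = alin (@gen_level n) (@polygon_relators_const n k) (d c z).
  have -> : pgen z = alin (@gen_level n) (@polygon_relators_const n k)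
      (fun y => (z == y)%:R) by exact: alin_delta.
  by rewrite /alin scaler_sumr; apply: eq_bigr => y' _; rewrite scalerA.
rewrite !E => /(alin_inj (@polygon_rels1 n k))/(_ x); rewrite /d eqxx mulr1 => aE.
have [yx|ne] := eqVneq y x; first by rewrite aE yx eqxx mulr1.
by move: a0; rewrite aE (negPf ne) mulr0 eqxx.
Qed.

Lemma polygon_aut_group : (3 <= n)%N ->
  exists f : units k * subg_of (dihedral n) -> AutGF PP,
    [/\ bijective f, {morph f : x y / (x * y)%g}
      & forall (a : units k) (s : subg_of (dihedral n)) (x : gen n),
          f (a, s) (polygon_gen x) = val a *: polygon_gen (sgval s x)].
Proof.
move=> n3.
have ex (p : units k * subg_of (dihedral n)) : exists phi : AutGF PP,
    forall x, phi (pgen x) = val p.1 *: pgen (sgval p.2 x).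
  exact/polygon_aut_exists/subgP.
have [f fE] := choice ex.
have unit0 (z : units k) : val z != 0 by rewrite -unitfE; apply: valP.
have f_inj : injective f.
  move=> [a s] [b t] fst.
  have e x : sgval s x = sgval t x /\ val a = val b.
    by have := fE (b, t) x; rewrite -fst fE; apply: scale_pgen_inj (unit0 a).
  have [_ ab] := e gU; congr (_, _); first exact: val_inj.
  by apply/val_inj/permP => x; have [] := e x.
have f_surj phi : exists p, f p = phi.
  have [b b0 [g gD phiE]] := polygon_aut_form n3 phi.
  have bu : b \is a GRing.unit by rewrite unitfE.
  exists (Units bu, subg _ g); apply: (@aut_eq k PP) => x.
  by rewrite -[agen x]/(pgen x) fE /= subgK // phiE.
have [g gE] := choice f_surj.
exists f; split=> [|p q|a s x]; last exact: fE.
- by apply: (Bijective (g := g)) => [p|]; [apply: f_inj; rewrite gE|exact: gE].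
apply: (@aut_eq k PP) => x; rewrite -[agen x]/(pgen x) fE.
rewrite -[RHS]/(f q (f p (pgen x))) fE linearZ /= fE scalerA.
by rewrite /= permM.
Qed.

End PolygonAutGroup.

(** * The digon *)

Lemma form1_sum (k : fieldType) (B : algType k) (X : finType) (g : X -> B)
    (a b c : X -> k) (lin := fun d : X -> k => \sum_x d x *: g x) :
  lin a * (lin b - lin c) - lin b ^+ 2 + lin c ^+ 2 =
  \sum_x \sum_y (a x * (b y - c y) - b x * b y + c x * c y) *: (g x * g y).
Proof.
have linM d e : lin d * lin e = \sum_x \sum_y (d x * e y) *: (g x * g y).
  rewrite mulr_suml; apply: eq_bigr => x _; rewrite mulr_sumr.
  by apply: eq_bigr => y _; rewrite -scalerAl -scalerAr scalerA.
rewrite mulrBr !expr2 !linM -!sumrB -big_split /=; apply: eq_bigr => x _.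
rewrite -!sumrB -big_split /=; apply: eq_bigr => y _.
by rewrite -!scalerBl -scalerDl mulrBr.
Qed.

Lemma ord3P (Q : 'I_3 -> Prop) : Q 0 -> Q 1 -> Q 2%:R -> forall i, Q i.
Proof.
move=> Q0 Q1 Q2 [[|[|[|//]]] lt].
- by rewrite (_ : Ordinal lt = 0) //; apply/val_inj.
- by rewrite (_ : Ordinal lt = 1) //; apply/val_inj.
- by rewrite (_ : Ordinal lt = 2%:R) //; apply/val_inj.
Qed.

Lemma sum_ord3 (V : nmodType) (F : 'I_3 -> V) : \sum_i F i = F 0 + F 1 + F 2%:R.
Proof.
rewrite !big_ord_recr big_ord0 /= add0r.
by congr (F _ + F _ + F _); apply/val_inj.
Qed.

Section Digon.
Variable k : fieldType.
Local Notation DD := (digon_presentation k).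
Local Notation A := (presented_alg DD).
Local Notation dgen := (@digon_gen k).
Local Notation L := (@alin k 'I_3 digon_level [:: digon_rel k]
  (@digon_relators_const k)).

Lemma digon_rels1 : {in [:: digon_rel k], forall r x, co1 x r = 0}.
Proof. by move=> r; rewrite inE => /eqP -> x; apply: co1_form1; apply: const_fgen. Qed.

Lemma digon_form1_gen :
  dgen 0 * (dgen 1 - dgen 2%:R) - dgen 1 ^+ 2 + dgen 2%:R ^+ 2 = 0.
Proof.
apply: etrans (esym (rmorph_form1 (@alg_pi k DD) _ _ _)) _; apply: alg_pi_relator.
exact: mem_head.
Qed.

Definition digon_rel_coef (x y : 'I_3) : k :=
  (x == 0)%:R * ((y == 1)%:R - (y == 2%:R)%:R) - (x == 1)%:R * (y == 1)%:R +
  (x == 2%:R)%:R * (y == 2%:R)%:R.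

Lemma digon_form1_coefs (a b c : 'I_3 -> k) :
  L a * (L b - L c) - L b ^+ 2 + L c ^+ 2 = 0 ->
  exists la : k, forall x y,
    a x * (b y - c y) - b x * b y + c x * c y = la * digon_rel_coef x y.
Proof.
have coefE x y : co2 x y (digon_rel k) = digon_rel_coef x y.
  by apply: etrans (co2_form1 x y (const_fgen _ _) (const_fgen _ _) (const_fgen _ _)) _;
    congr (_ * (_ - _) - _ * _ + _ * _); apply: co1_gen.
rewrite -!(alg_pi_flin digon_level (@digon_relators_const k)) => rel.
have piE := rmorph_form1 (@alg_pi k DD) (flin a) (flin b) (flin c).
have /(alg_pi_eq0 (P := DD))/(rel_ideal_co2 digon_rels1)[s sP aE] := etrans piE rel.
exists (\sum_(t <- s) t.1) => x y; rewrite -co2_form1_flin aE mulr_suml.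
rewrite big_seq [RHS]big_seq; apply: eq_bigr => t /sP.
by rewrite inE => /eqP ->; rewrite coefE.
Qed.

(** Expanded in products of generators, the left side is [la] times the same expression for the
    generators themselves, which is the defining relation. *)
Lemma digon_form1_eq0 (a b c : 'I_3 -> k) (la : k) :
  (forall x y,
    a x * (b y - c y) - b x * b y + c x * c y = la * digon_rel_coef x y) ->
  L a * (L b - L c) - L b ^+ 2 + L c ^+ 2 = 0.
Proof.
move=> laE; apply: etrans (form1_sum _ _ _ _) _.
pose d (x y : 'I_3) : k := (y == x)%:R.
have dE x : dgen x = L (d x).
  apply: etrans (alin_delta _) _.
  by apply: eq_bigr => y _; rewrite /d eq_sym.
transitivity (la *: (L (d 0) * (L (d 1) - L (d 2%:R)) - L (d 1) ^+ 2 + L (d 2%:R) ^+ 2)).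
  apply: etrans (congr1 (GRing.scale la) (esym (form1_sum _ _ _ _))).
  rewrite scaler_sumr; apply: eq_bigr => x _; rewrite scaler_sumr.
  by apply: eq_bigr => y _; rewrite scalerA laE.
by rewrite -!dE; apply: etrans (congr1 _ digon_form1_gen) (scaler0 _ _).
Qed.

Lemma digon_lin_alin (c : 'rV[k]_3) : digon_lin c = L (c 0).
Proof. by []. Qed.

Lemma digon_lin_inj : injective (@digon_lin k).
Proof.
move=> c d; rewrite !digon_lin_alin => /(alin_inj digon_rels1) cd.
by apply/rowP.
Qed.

Lemma digon_linD : {morph @digon_lin k : c d / c + d}.
Proof.
move=> c d; rewrite -big_split; apply: eq_bigr => i _.
by rewrite mxE scalerDl.
Qed.

Lemma digon_linZ (z : k) c : digon_lin (z *: c) = z *: digon_lin c.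
Proof. by rewrite scaler_sumr; apply: eq_bigr => i _; rewrite mxE scalerA. Qed.

Lemma digon_lin_mul (h : {linear A -> A}) (M : 'M[k]_3) c :
  (forall i, h (dgen i) = digon_lin (row i M)) ->
  h (digon_lin c) = digon_lin (c *m M).
Proof.
move=> hE; rewrite mulmx_sum_row.
rewrite (big_morph (@digon_lin k) digon_linD (_ : _ = 0)); last first.
  by rewrite -[X in digon_lin X](scale0r 0) digon_linZ scale0r.
rewrite raddf_sum; apply: eq_bigr => i _; rewrite digon_linZ -hE; exact: linearZZ.
Qed.

Lemma digon_mx_inv (c11 c21 c12 : k) : c11 + c21 != 0 -> c11 - c12 != 0 ->
  exists d11 d21 d12, digon_mx c11 c21 c12 *m digon_mx d11 d21 d12 = 1.
Proof.
move=> b0 mu0; pose de := (c11 + c21) * (c11 - c12).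
(* The determinant of the lower right block factors as [de], and its adjugate divided by [de] has
   the same shape. *)
exists ((c11 + c21 - c12) / de), (- c21 / de), (- c12 / de).
apply/matrixP; rewrite /de.
by apply: ord3P; apply: ord3P; rewrite !mxE sum_ord3 !mxE /=;
  rewrite ?mulr0n ?mulr1n; field; rewrite b0 mu0.
Qed.

Lemma digon_mx_unit (c11 c21 c12 : k) : digon_mx c11 c21 c12 \is a GRing.unit ->
  c11 + c21 != 0 /\ c11 - c12 != 0.
Proof.
set M := digon_mx _ _ _ => Mu; split; apply/eqP => e0.
  have /matrixP/(_ 0 0) := mulVr Mu.
  rewrite !mxE sum_ord3 !mxE /= e0 !mulr0 !addr0.
  by move/esym/eqP; rewrite oner_eq0.
(* Now rows 1 and 2 of [M] coincide, so the corresponding rows of [M * M^-1] would coincide as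
   well. *)
have e : c11 = c12 by apply/eqP; rewrite -subr_eq0 e0.
have /matrixP MV := mulrV Mu; have := MV 1 1; have := MV 2%:R 1.
rewrite !mxE !sum_ord3 !mxE /= e => e1 e2.
have : (0 : k) = 1.
  by apply: etrans (esym e1) (etrans _ e2); ring.
by move/esym/eqP; rewrite oner_eq0.
Qed.

Lemma digon_mx_hom (c11 c21 c12 : k) : exists h : {lrmorphism A -> A},
  forall x, h (dgen x) = digon_lin (row x (digon_mx c11 c21 c12)).
Proof.
set M := digon_mx _ _ _.
apply: (@presented_hom k DD) => r; rewrite inE => /eqP ->.
apply: etrans (rmorph_form1 (free_hom _) _ _ _) _; rewrite /= !free_hom_gen.
(* The factor is read off from the word [v_12 w_1]: the coefficient of [v_12] in its own image times
   that of [w_1] in the image of [w_1 - w_2]. *)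
apply: (digon_form1_eq0 (la := (c11 + c21) * (c11 - c12))).
by apply: ord3P; apply: ord3P; rewrite !mxE /= /digon_rel_coef /=;
  rewrite ?mulr0n ?mulr1n; ring.
Qed.

Lemma digon_mx_lin_part (c11 c21 c12 : k) x :
  @lin_part k DD (digon_level x) (digon_lin (row x (digon_mx c11 c21 c12))).
Proof.
apply: alin_lin_part => y; rewrite !mxE; move: x y.
by apply: ord3P; apply: ord3P; rewrite //= eqxx.
Qed.

Lemma digon_aut_exists (c11 c21 c12 : k) :
  digon_mx c11 c21 c12 \is a GRing.unit ->
  exists phi : AutGF DD, forall x, phi (dgen x) = digon_lin (row x (digon_mx c11 c21 c12)).
Proof.
move=> /digon_mx_unit[b0 mu0]; have [d11 [d21 [d12 MN]]] := digon_mx_inv b0 mu0.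
have [h hE] := digon_mx_hom c11 c21 c12; set M := digon_mx c11 c21 c12 in hE MN.
pose N := digon_mx d11 d21 d12; rewrite -/N in MN.
have [h' h'E] : exists h' : {lrmorphism A -> A},
    forall x, h' (dgen x) = digon_lin (row x N).
  exact: digon_mx_hom.
have NM := mulmx1C MN.
have genE x : dgen x = digon_lin (row x 1%:M).
  apply: etrans (alin_delta _) _.
  by apply: eq_bigr => y _; rewrite !mxE.
have hP : gf_aut (@graded_part k DD) (@filtered_part k DD) h.
  apply: (gf_aut_lin (h' := h')) => x.
  - apply: etrans (congr1 h (h'E x)) _; apply: etrans (digon_lin_mul _ hE) _.
    by rewrite -row_mul NM -genE.
  - apply: etrans (congr1 h' (hE x)) _; apply: etrans (digon_lin_mul _ h'E) _.
    by rewrite -row_mul MN -genE.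
  - by rewrite -[agen x]/(dgen x) hE; apply: digon_mx_lin_part.
  - by rewrite -[agen x]/(dgen x) h'E; apply: digon_mx_lin_part.
by exists (MkAut (asboolT hP)) => x; apply: hE.
Qed.

Lemma digon_aut_mx (phi : AutGF DD) : exists M : units 'M[k]_3,
  (forall x, phi (dgen x) = digon_lin (row x (val M))) /\
  exists c11 c21 c12, val M = digon_mx c11 c21 c12.
Proof.
have [m [m' [mE m_lev m'_lev mm']]] := aut_alin_inv digon_rels1 phi.
pose M : 'M[k]_3 := \matrix_(i, j) m i j; pose M' : 'M[k]_3 := \matrix_(i, j) m' i j.
have MM' : M *m M' = 1%:M.
  apply/matrixP => i j; rewrite !mxE -mm'; apply: eq_bigr => l _; by rewrite !mxE.
have Mu : M \is a GRing.unit by have [] := mulmx1_unit MM'.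
exists (Units Mu); split=> [x|].
  by apply: etrans (mE x) _; apply: eq_bigr => y _; rewrite !mxE.
have [la laE] : exists la : k, forall x y,
    m 0 x * (m 1 y - m 2%:R y) - m 1 x * m 1 y + m 2%:R x * m 2%:R y =
    la * digon_rel_coef x y.
  apply: digon_form1_coefs; rewrite -!mE.
  apply: etrans (esym (rmorph_form1 phi _ _ _)) _.
  exact: etrans (congr1 phi digon_form1_gen) (raddf0 _).
have m0 x y : (digon_level x < digon_level y)%N -> m x y = 0.
  by rewrite ltnNge => lt; apply/eqP; apply: contraNT lt => /m_lev.
have m'0 x y : (digon_level x < digon_level y)%N -> m' x y = 0.
  by rewrite ltnNge => lt; apply/eqP; apply: contraNT lt => /m'_lev.
have m10 : m 1 0 = 0 by apply: m0.
have m20 : m 2%:R 0 = 0 by apply: m0.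
have b0 : m 0 0 != 0.
  apply/eqP => b0; have := mm' 0 0; rewrite sum_ord3 b0 (m'0 1 0) // (m'0 2%:R 0) //.
  by rewrite mul0r !mulr0 !addr0 => /esym/eqP; rewrite oner_eq0.
pose mu := m 1 1 - m 2%:R 1.
have coefE : ((digon_rel_coef 0 1 = 1) * (digon_rel_coef 0 2%:R = -1) *
    (digon_rel_coef 1 1 = -1) * (digon_rel_coef 2%:R 1 = 0) *
    (digon_rel_coef 2%:R 2%:R = 1))%type.
  by do !split; rewrite /digon_rel_coef /= ?mulr0n ?mulr1n; ring.
have laE' : la = m 0 0 * mu.
  by have := laE 0 1; rewrite coefE m10 m20 !mul0r subr0 addr0 mulr1.
have muN : m 1 2%:R - m 2%:R 2%:R = - mu.
  apply: (mulfI b0); have := laE 0 2%:R.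
  by rewrite coefE m10 m20 !mul0r subr0 addr0 mulrN1 laE' mulrN.
(* If [mu] vanished, [w_1] and [w_2] would have the same image, against invertibility. *)
have mu0 : mu != 0.
  apply/eqP => mu0; have e1 : m 1 1 = m 2%:R 1 by apply/eqP; rewrite -subr_eq0 -/mu mu0.
  have e2 : m 1 2%:R = m 2%:R 2%:R by apply/eqP; rewrite -subr_eq0 muN mu0 oppr0.
  have rows y : m 1 y = m 2%:R y by move: y; apply: ord3P; rewrite ?m10.
  have := mm' 1 1; rewrite (eq_bigr (fun y => m 2%:R y * m' y 1)) => [|y _].
    by rewrite mm' => /esym/eqP; rewrite oner_eq0.
  by rewrite rows.
have [|||||xE yE cE c'E] := @edge_solve k (m 1 1) (m 1 2%:R) (m 2%:R 1) (m 2%:R 2%:R)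
    (m 0 1) (m 0 2%:R) (m 0 0) mu mu0 => //.
- by have := laE 1 1; rewrite coefE laE' mulrN1.
- by have := laE 2%:R 1; rewrite coefE mulr0.
- by have := laE 2%:R 2%:R; rewrite coefE muN laE' mulr1.
(* The two row sums agree, which leaves these three entries free and expresses the last entry of the
   [w] block through them. *)
exists (m 1 1), (m 1 2%:R), (m 2%:R 1).
have {}yE : m 2%:R 2%:R = m 1 1 + m 1 2%:R - m 2%:R 1 by rewrite xE -yE addrC addKr.
apply/matrixP; apply: ord3P; apply: ord3P; rewrite !mxE //=.
- by rewrite cE -xE; ring.
- by rewrite c'E yE -xE; ring.
Qed.

Lemma digon_aut_group : exists f : AutGF DD -> units 'M[k]_3,
  [/\ injective f, {morph f : x y / (x * y)%g},
      forall (phi : AutGF DD) (c : 'rV[k]_3),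
        phi (digon_lin c) = digon_lin (c *m val (f phi))
    & forall M : units 'M[k]_3, (exists phi, f phi = M) <->
        exists c11 c21 c12 : k, val M = digon_mx c11 c21 c12].
Proof.
have [f fP] := choice digon_aut_mx.
have fE (phi : AutGF DD) x : phi (dgen x) = digon_lin (row x (val (f phi))).
  by case: (fP phi).
have f_lin (phi : AutGF DD) c : phi (digon_lin c) = digon_lin (c *m val (f phi)).
  exact: digon_lin_mul (fE phi).
exists f; split=> //.
- by move=> phi psi e; apply: (@aut_eq k DD) => x; rewrite -[agen x]/(dgen x) !fE e.
(* The product applies [phi] first, matching right multiplication of row vectors by the matrix of
   [phi] and then by that of [psi]. *)
- move=> phi psi; apply/val_inj/row_matrixP => x; apply: digon_lin_inj.
  rewrite -fE -[LHS]/(psi (phi (dgen x))) fE f_lin; congr digon_lin.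
  by rewrite -row_mul.
move=> M; split=> [[phi <-]|[c11 [c21 [c12 ME]]]]; first by case: (fP phi).
have [|phi phiE] := @digon_aut_exists c11 c21 c12; first by rewrite -ME; apply: valP.
exists phi; apply/val_inj/row_matrixP => x; apply: digon_lin_inj.
by rewrite -fE phiE -ME.
Qed.

End Digon.

Theorem theorem4p4 (k : fieldType) :
  (forall n : nat, (3 <= n)%N ->
     exists f : units k * subg_of (dihedral n) -> AutGF (polygon_presentation n k),
       [/\ bijective f,
           {morph f : x y / (x * y)%g}
         & forall (a : units k) (s : subg_of (dihedral n)) (x : gen n),
             f (a, s) (polygon_gen x) = val a *: polygon_gen (sgval s x)])
  /\
  (exists f : AutGF (digon_presentation k) -> units 'M[k]_3,
     [/\ injective f,
         {morph f : x y / (x * y)%g},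
         forall (phi : AutGF (digon_presentation k)) (c : 'rV[k]_3),
           phi (digon_lin c) = digon_lin (c *m val (f phi))
       & forall M : units 'M[k]_3,
           (exists phi, f phi = M) <->
           exists c11 c21 c12 : k, val M = digon_mx c11 c21 c12]).
Proof.
split; last exact: digon_aut_group.
by move=> n n3; apply: polygon_aut_group.
Qed.
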